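(* Let $X_0=(u_0,v_0)^\top\in\mathbb H^1$. Suppose there are $k\in\mathbb N^+$, $c_2>0$ and polynomials $b_1,b_2,b_3$ of degree $2k+1$, $2k$, $k$ respectively such that for all $u,\widetilde u\in\dot{\mathbb H}^1$ $$\|f(u)\|_{L^2}\le b_1(\|u\|_{\dot{\mathbb H}^1}),\qquad \|f(u)-f(\widetilde u)\|_{L^2}\le b_2(\|u\|_{\dot{\mathbb H}^1},\|\widetilde u\|_{\dot{\mathbb H}^1})\|u-\widetilde u\|_{\dot{\mathbb H}^1},$$ $$\|g(\Theta u)\|_{\mathcal L_2(\mathbf Q^{1/2}(\dot{\mathbb H}),\dot{\mathbb H})}\le c_2(1+\|u\|_{\dot{\mathbb H}^1}),$$ $$\|g(\Theta u)-g(\Theta\widetilde u)\|_{\mathcal L_2(\mathbf Q^{1/2}(\dot{\mathbb H}),\dot{\mathbb H})}\le b_3(\|u\|_{\dot{\mathbb H}^1},\|\widetilde u\|_{\dot{\mathbb H}^1})\|u-\widetilde u\|_{\dot{\mathbb H}^1},$$ and that there are constants $c_3,c_4,\delta_0>0$ such that the potential $F(u)=\int_{\mathcal O}\widetilde F(u(x))\,dx$ satisfies $f(u)=\widetilde F'(u)$ and $F(u)+\delta_0\ge c_3\|u\|_{L^2}^2+c_4\|u\|_{L^{2k+2}}^{2k+2}$. Then for every $p\ge1$ there is a constant $C(p,X_0,\mathbf Q,T)>0$, independent of $N$ and $\tau$, such that for every $N\in\mathbb N^+$ with $\tau=T/N$, $$\sup_{n\le N}\mathbb E\big[V^p(u_n,v_n,q_n)\big]\le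 C(p,X_0,\mathbf Q,T),$$ where $(u_n,v_n,q_n)$ is the numerical solution of either of the two schemes defined in the context (midpoint SAV or exponential Euler SAV) and $V(u,v,q)=\frac12\|u\|_{\dot{\mathbb H}^1}^2+\frac12\|v\|_{L^2}^2+q^2$.
   Context: **Setting.** Let $d\le3$, $T>0$, and let $\mathcal O\subset\mathbb R^d$ be a bounded convex domain with polygonal boundary. $\Lambda=\sum_{i=1}^d\partial_{x_i}^2$ is the Laplacian with homogeneous Dirichlet boundary condition, $-\Lambda$ having eigenvalues $0<\lambda_1\le\lambda_2\le\cdots$ and an orthonormal eigenbasis $\{e_i\}$ of $L^2=L^2(\mathcal O;\mathbb R)$. For $r\in\mathbb R$, $\dot{\mathbb H}^r=\mathcal D((-\Lambda)^{r/2})$ with norm $\|x\|_{\dot{\mathbb H}^r}=\|(-\Lambda)^{r/2}x\|_{L^2}$; $\dot{\mathbb H}=\dot{\mathbb H}^0=L^2$; $\mathbb H^r=\dot{\mathbb H}^r\times\dot{\mathbb H}^{r-1}$ with the product norm. On a filtered probability space, $W(t)=\sum_{k\ge1}\mathbf Q^{1/2}e_k\beta_k(t)$ with $\beta_k$ i.i.d. real Brownian motions, and $\mathbf Q$ a symmetric positive definite operator on $L^2$ of finite trace (so $\|\mathbf Q^{1/2}\|_{\mathcal L_2(\dot{\mathbb H},\dot{\mathbb H})}<\infty$). $\mathcal L_2(\mathbf Q^{1/2}(\dot{\mathbb H}),\dot{\mathbb H})$ is the space of Hilbert–Schmidt operators, with $\|G\|^2=\sum_i\|G\mathbf Q^{1/2}e_i\|_{L^2}^2$.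 Put $\Theta u=(u,\partial_{x_1}u,\dots,\partial_{x_d}u)$; $f:\dot{\mathbb H}^1\to\dot{\mathbb H}$ and $g:\dot{\mathbb H}^1\otimes\dot{\mathbb H}^{\otimes d}\to\mathcal L_2(\mathbf Q^{1/2}(\dot{\mathbb H}),\dot{\mathbb H})$. The schemes approximate the stochastic wave equation $du=v\,dt$, $dv=\Lambda u\,dt-f(u)\,dt+g(\Theta u)\,dW$ with (deterministic) initial value $X_0=(u_0,v_0)^\top$. The constant $\delta_0$ is chosen such that in addition $F(u)+\delta_0\ge c>0$ for all $u\in\dot{\mathbb H}^1$, for some constant $c$. **Schemes.** Let $t_n=n\tau$, $\delta W_n=W(t_{n+1})-W(t_n)$, initial values $u_0,v_0$ and $q_0=\sqrt{F(u_0)+\delta_0}$. In both schemes either $\widehat u_n=u_n$ for all $n$, or $\widehat u_n=\frac{3u_n-u_{n-1}}2$ for all $n$ with $u_{-1}=u_0$; and, for $n=0,\dots,N-1$, $$q_{n+1}=q_n+\frac{\langle f(\widehat u_n),u_{n+1}-u_n\rangle_{L^2}}{2\sqrt{F(\widehat u_n)+\delta_0}}.$$ *Midpoint SAV scheme:* $$u_{n+1}=u_n+\tfrac\tau2(v_n+v_{n+1})+\tfrac\tau2g(\Theta u_n)\delta W_n,$$ $$v_{n+1}=v_n+\tfrac\tau2\Lambda(u_n+u_{n+1})-\tau\frac{f(\widehat u_n)}{\sqrt{F(\widehat u_n)+\delta_0}}\frac{q_n+q_{n+1}}2+g(\Theta u_n)\delta W_n.$$ *Exponential Euler SAV scheme:*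 with $X_n=(u_n,v_n)^\top$, $A=\begin{bmatrix}0&I\\ \Lambda&0\end{bmatrix}$ and $E(t)=e^{tA}$, $$X_{n+1}=E(\tau)X_n+A^{-1}(E(\tau)-I)\Big(0,-\tfrac{f(\widehat u_n)}{\sqrt{F(\widehat u_n)+\delta_0}}\tfrac{q_n+q_{n+1}}2\Big)^\top+E(\tau)(0,g(\Theta u_n)\delta W_n)^\top.$$ *)

(* Defs.v *)
From HB Require Import structures.
From mathcomp Require Import all_boot all_order all_algebra.
From mathcomp Require Import all_classical all_reals all_analysis.
From mathcomp Require Import measurable_realfun.
From mathcomp Require mpoly.
Set Implicit Arguments.
Unset Strict Implicit.
Unset Printing Implicit Defensive.
Import Order.TTheory GRing.Theory Num.Theory.
Import numFieldNormedType.Exports.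
Local Open Scope classical_set_scope.
Local Open Scope ring_scope.


(* Borel sigma-algebra of R^n, generated by the coordinates. *)
Section rV_measurable.
Context {R : realType} {n : nat}.

Let coor (i : 'I_n) (x : 'rV[R]_n) : R := x ord0 i.

HB.instance Definition _ :=
  @isMeasurable.Build (measure_tuple_display default_measure_display)
    'rV[R]_n (g_sigma_preimage coor)
    (@sigma_algebra0 _ _ _) (@sigma_algebraC _ _) (@sigma_algebra_bigcup _ _ _).

Lemma measurable_coor (i : 'I_n) :
  measurable_fun setT (fun x : 'rV[R]_n => x ord0 i).
Proof.
move=> _ B mB; rewrite setTI; apply: sub_sigma_algebra => /=.
rewrite -bigcup_seq/=; exists i => /=; first by rewrite mem_index_enum.
by exists B => //; rewrite setTI.
Qed.

Lemma measurable_rV d (T : measurableType d) (f : T -> 'rV[R]_n) :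
  (forall i, measurable_fun setT (fun x => f x ord0 i)) -> measurable_fun setT f.
Proof.
move=> mf; apply: (measurability (\big[setU/set0]_(i < n) 
   preimage_set_system setT (coor i) measurable)) => //.
move=> _ [A HA <-].
move: HA; rewrite -bigcup_seq/= => -[i _ [B mB <-]].
rewrite setTI setTI; have := mf i measurableT B mB; rewrite setTI; exact.
Qed.

Lemma open_measurable_rV (O : set 'rV[R]_n) : open O -> measurable O.
Proof.
move=> oO.
pose box (p : 'rV[rat]_n * nat) : set 'rV[R]_n :=
  [set x | forall i, ball (ratr (p.1 ord0 i) : R) (p.2.+1%:R^-1) (x ord0 i)].
have mbox p : measurable (box p).
  have -> : box p = \bigcap_(i in [set: 'I_n])
     ((fun x : 'rV[R]_n => x ord0 i) @^-1` ball (ratr (p.1 ord0 i) : R) (p.2.+1%:R^-1)).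
    by apply/seteqP; split => x /= h i; [move=> _; exact: h|exact: h].
  apply: fin_bigcap_measurable => // i _; rewrite -[X in measurable X]setTI.
  by apply: measurable_coor => //; exact: measurable_ball.
have -> : O = \bigcup_p (if pselect (box p `<=` O) then box p else set0).
  apply/seteqP; split => [x Ox|x [p _]]; last by case: pselect => // h /h.
  have /nbhs_ballP[e /= e0 xeO] : nbhs x O by apply: open_nbhs_nbhs; split.
  have e20 : 0 < e / 2 by rewrite divr_gt0.
  have [m _ hm] := near_infty_natSinv_lt (PosNum e20).
  have {}hm := hm m (leqnn m); rewrite /= in hm.
  have q0 (i : 'I_n) : {q : rat | ball (x ord0 i) (m.+1%:R^-1) (ratr q)}.
    apply: cid; have /rat_in_itvoo[q hq] : x ord0 i - m.+1%:R^-1 < x ord0 i + m.+1%:R^-1.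
      by rewrite ltrD2l gtrN // invr_gt0.
    exists q; rewrite /ball/= ltr_distlC.
    by move: hq; rewrite in_itv/=.
  exists (\row_i sval (q0 i), m) => //=.
  case: pselect => [_ i|]/=.
    by rewrite mxE; apply: ball_sym; case: (q0 i).
  case=> y /= hy; apply: xeO; split => // i j.
  rewrite (ord1 i) [e]splitr.
  have h1 : ball (x ord0 j) (e / 2) (ratr (sval (q0 j)) : R).
    by apply: (le_ball (ltW hm)); case: (q0 j).
  apply: (ball_triangle h1); apply: (le_ball (ltW hm)).
  by have := hy j; rewrite mxE.
apply: countable_bigcupT_measurable.
  exact: countableP.
by move=> p; case: (pselect (box p `<=` O)) => h; [exact: mbox|exact: measurable0].
Qed.

End rV_measurable.

Section lebesgue_rV.
Context {R : realType}.

Definition cons_rV n (x : measurableTypeR R * 'rV[R]_n) : 'rV[R]_n.+1 :=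
  \row_j (if unlift ord0 j is Some i then x.2 ord0 i else x.1).

Lemma measurable_cons_rV n : measurable_fun setT (@cons_rV n).
Proof.
apply: measurable_rV => i; rewrite /cons_rV.
under eq_fun do rewrite mxE.
case: unliftP => [j _|_]; last exact: measurable_fst.
exact: (measurableT_comp (@measurable_coor R n j) measurable_snd).
Qed.

Section step.
Context n (mu : {sigma_finite_measure set 'rV[R]_n -> \bar R}).

Definition lebesgue_rVS : set 'rV[R]_n.+1 -> \bar R :=
  pushforward (@lebesgue_measure R \x mu)%E (@cons_rV n).

Let lebesgue_rVS0 : lebesgue_rVS set0 = 0%E.
Proof. by rewrite /lebesgue_rVS /pushforward preimage_set0 measure0. Qed.

Let lebesgue_rVS_ge0 A : (0 <= lebesgue_rVS A)%E.
Proof. by rewrite /lebesgue_rVS /pushforward; exact: measure_ge0. Qed.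

Let lebesgue_rVS_sigma_additive : semi_sigma_additive lebesgue_rVS.
Proof.
move=> F mF tF mUF; rewrite /lebesgue_rVS /pushforward preimage_bigcup.
have mcons A : measurable A -> measurable (@cons_rV n @^-1` A).
  by move=> mA; rewrite -[X in measurable X]setTI; exact: measurable_cons_rV.
apply: measure_semi_sigma_additive.
- by move=> k; exact: mcons.
- apply/trivIsetP => /= i j _ _ ij; rewrite -preimage_setI.
  by move/trivIsetP : tF => /(_ i j) ->//; rewrite preimage_set0.
- by rewrite -preimage_bigcup; exact: mcons.
Qed.

HB.instance Definition _ := isMeasure.Build _ _ _ lebesgue_rVS
  lebesgue_rVS0 lebesgue_rVS_ge0 lebesgue_rVS_sigma_additive.

Let sigma_finite_step : sigma_finite setT lebesgue_rVS.
Proof.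
have /sigma_finiteP[F [FT ndF Foo]] := sigma_finiteT (@lebesgue_measure R).
have /sigma_finiteP[G [GT ndG Goo]] := sigma_finiteT mu.
pose h (v : 'rV[R]_n.+1) : measurableTypeR R * 'rV[R]_n := (v ord0 ord0, \row_i v ord0 (lift ord0 i)).
have mh : measurable_fun setT h.
  apply/measurable_fun_pairP; split.
    exact: measurable_coor.
  apply: measurable_rV => i /=.
  by under eq_fun do rewrite /= mxE; exact: measurable_coor.
have hK : cancel (@cons_rV n) h.
  move=> [x v]; rewrite /h /cons_rV; congr pair; rewrite ?mxE ?unlift_none//.
  by apply/rowP => i; rewrite !mxE liftK.
exists (fun k => h @^-1` (F k `*` G k)) => [|k].
  apply/seteqP; split => // v _.
  have [i _ Fi] : (\bigcup_k F k) (h v).1 by rewrite -FT.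
  have [j _ Gj] : (\bigcup_k G k) (h v).2 by rewrite -GT.
  exists (maxn i j) => //; split => /=.
  - by move: Fi; exact/subsetPset/ndF/leq_maxl.
  - by move: Gj; exact/subsetPset/ndG/leq_maxr.
have [mF Fk] := Foo k; have [mG Gk] := Goo k; split.
  by rewrite -[X in measurable X]setTI; apply: mh => //; exact: measurableX.
rewrite /lebesgue_rVS /pushforward (_ : _ @^-1` _ = F k `*` G k).
  by rewrite product_measure1E// lte_mul_pinfty// ge0_fin_numE.
by rewrite -comp_preimage (_ : h \o _ = id)//; apply/funext => x; exact: hK.
Qed.

HB.instance Definition _ :=
  Measure_isSigmaFinite.Build _ _ _ lebesgue_rVS sigma_finite_step.

End step.

(* Lebesgue measure on R^n, as the iterated product of lebesgue_measure. *)
Fixpoint lebesgue_rV n : {sigma_finite_measure set 'rV[R]_n -> \bar R} :=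
  if n is m.+1 then lebesgue_rVS (lebesgue_rV m) else dirac (0 : 'rV[R]_0).

End lebesgue_rV.

Section domain.
Context {R : realType} (d : nat).

(* Boundary of an open set O: closure O `\` O.  A flat (polyhedral) boundary
   is one that is covered by finitely many affine hyperplanes. *)
Record polygonal_domain := PolygonalDomain {
  dom :> set 'rV[R]_d ;
  dom_open : open dom ;
  dom_nonempty : dom !=set0 ;
  dom_bounded : bounded_set dom ;
  dom_convex : convex_set (dom : set (convex_lmodType 'rV[R]_d)) ;
  dom_polygonal : exists (m : nat) (a : 'I_m -> 'rV[R]_d) (b : 'I_m -> R),
    (forall j, a j != 0) /\
    closure dom `\` dom `<=`
      [set x | exists j, \sum_(i < d) a j ord0 i * x ord0 i = b j]
}.

Definition leb (O : polygonal_domain) :=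
  mrestr (lebesgue_rV d) (open_measurable_rV (@dom_open O)).

HB.instance Definition _ (O : polygonal_domain) := Measure.on (leb O).

End domain.

Arguments polygonal_domain R d : clear implicits.

Lemma le1_2 (R : realType) : (1 <= 2%:E :> \bar R)%E.
Proof. by rewrite lee_fin ler1n. Qed.

(* Square-integrable functions on O; as elements of L^2(O) they are identified
   up to eqL2. *)
Definition L2 (R : realType) (d : nat) (O : polygonal_domain R d) :=
  LfunType (leb O) (@le1_2 R).

Section L2_space.
Context {R : realType} {d : nat} {O : polygonal_domain R d}.
Local Notation L2 := (L2 O).
Implicit Types u v w : L2.

Definition eqL2 u v : Prop := {ae leb O, forall x, u x = v x}.

Definition ip u v : R := \int[leb O]_x (u x * v x).

Definition norm2 u : R := Num.sqrt (ip u u).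

Definition L2cvg (v : nat -> 'rV[R]_d -> R) (w : 'rV[R]_d -> R) : Prop :=
  (\int[leb O]_x ((v n x - w x) ^+ 2)%:E)%E @[n --> \oo] --> 0%E.

Definition linearL2 (A : L2 -> L2) : Prop :=
  forall (a : R) u v, eqL2 (A (a *: u + v)) (a *: A u + A v).

Definition boundedL2 (A : L2 -> L2) : Prop :=
  exists C : R, forall u, norm2 (A u) <= C * norm2 u.

Definition symmetricL2 (A : L2 -> L2) : Prop :=
  forall u v, ip (A u) v = ip u (A v).

End L2_space.

Section dirichlet.
Context {R : realType} {d : nat} (O : polygonal_domain R d).
Local Notation L2 := (L2 O).
Implicit Types (phi : 'rV[R]_d -> R) (u w : L2).

Definition partial (i : 'I_d) phi : 'rV[R]_d -> R :=
  fun x => 'D_(delta_mx ord0 i) phi x.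

Fixpoint Cn (n : nat) phi : Prop :=
  continuous phi /\
  if n is m.+1 then forall i : 'I_d,
    (forall x, derivable phi x (delta_mx ord0 i)) /\ Cn m (partial i phi)
  else True.

Definition test_function phi : Prop :=
  (forall n, Cn n phi) /\
  exists K : set 'rV[R]_d,
    [/\ compact K, K `<=` O & forall x, ~ K x -> phi x = 0].

Definition is_weak_derivative (i : 'I_d) u w : Prop :=
  forall phi, test_function phi ->
    \int[leb O]_x (u x * partial i phi x) = - \int[leb O]_x (w x * phi x).

Definition weak_derivative (i : 'I_d) u : L2 :=
  xget 0 [set w | is_weak_derivative i u w].

Definition Theta u : L2 * ('I_d -> L2) := (u, fun i => weak_derivative i u).

(* H^1_0(O): the closure of the test functions in H^1(O). *)
Definition H10 u : Prop :=
  exists phi_ : nat -> 'rV[R]_d -> R, exists w : 'I_d -> L2,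
    [/\ forall n, test_function (phi_ n),
        L2cvg (O := O) phi_ u &
        forall i, L2cvg (O := O) (fun n => partial i (phi_ n)) (w i)].

(* u lies in H^1_0(O) and its distributional Laplacian is w. *)
Definition dirichlet_laplacian u w : Prop :=
  H10 u /\ forall phi, test_function phi ->
    \int[leb O]_x (u x * \sum_(i < d) partial i (partial i phi) x) =
    \int[leb O]_x (w x * phi x).

Record dirichlet_eigenbasis (e : nat -> L2) (lam : nat -> R) : Prop := {
  eigval_gt0 : forall i, 0 < lam i ;
  eigval_ndecr : forall i j, (i <= j)%N -> lam i <= lam j ;
  eigvec : forall i, dirichlet_laplacian (e i) (- lam i *: e i) ;
  eigvec_orthonormal : forall i j, ip (e i) (e j) = (i == j)%:R ;
  eigvec_basis : forall u,
    L2cvg (O := O) (fun n => (\sum_(i < n) ip u (e i) *: e i : L2)) u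
}.

End dirichlet.

Section spectral.
Context {R : realType} {d : nat} {O : polygonal_domain R d}.
Context (e : nat -> L2 O) (lam : nat -> R).
Local Notation L2 := (L2 O).
Implicit Types x y u v : L2.

(* y = (-Lambda)^s x = sum_i lam_i^s <x, e_i> e_i, the series converging in
   L^2(O); x lies in the domain of (-Lambda)^s iff there is such a y. *)
Definition is_frac (s : R) x y : Prop :=
  L2cvg (O := O)
    (fun n => (\sum_(i < n) (lam i `^ s * ip x (e i)) *: e i : L2)) y.

Definition frac_dom (s : R) : set L2 := [set x | exists y, is_frac s x y].

Definition frac (s : R) x : L2 := xget 0 [set y | is_frac s x y].

Definition Lap x : L2 := - frac 1 x.

Definition Hdot (r : R) : set L2 := frac_dom (r / 2).

Definition normHdot (r : R) x : R := norm2 (frac (r / 2) x).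

(* Hdot^1 x Hdot^0, where Hdot^0 = L^2(O) puts no condition on X.2. *)
Definition HH : set (L2 * L2) := [set X | Hdot 1 X.1].

Definition normHH (X : L2 * L2) : R :=
  Num.sqrt (normHdot 1 X.1 ^+ 2 + norm2 X.2 ^+ 2).

Definition eqHH (X Y : L2 * L2) : Prop := eqL2 X.1 Y.1 /\ eqL2 X.2 Y.2.

Definition wave_op (X : L2 * L2) : L2 * L2 := (X.2, Lap X.1).

Definition wave_dom : set (L2 * L2) :=
  [set X | frac_dom 1 X.1 /\ Hdot 1 X.2].

(* E(t) = e^{tA}: the strongly continuous group on HH with generator
   A = wave_op, whose domain is wave_dom. *)
Record is_wave_group (E : R -> L2 * L2 -> L2 * L2) : Prop := {
  wave_group_HH : forall t X, HH X -> HH (E t X) ;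
  wave_group_linear : forall t (a : R) X Y, HH X -> HH Y ->
    eqHH (E t (a *: X + Y)) (a *: E t X + E t Y) ;
  wave_group_bounded : forall t, exists C : R, forall X, HH X ->
    normHH (E t X) <= C * normHH X ;
  wave_group0 : forall X, HH X -> eqHH (E 0 X) X ;
  wave_groupD : forall s t X, HH X -> eqHH (E (s + t) X) (E s (E t X)) ;
  wave_group_continuous : forall X, HH X ->
    normHH (E t X - X) @[t --> 0^'] --> (0 : R) ;
  wave_group_generator : forall X Y, HH X -> HH Y ->
    (normHH (t^-1 *: (E t X - X) - Y) @[t --> 0^'] --> (0 : R)) <->
    (wave_dom X /\ eqHH (wave_op X) Y)
}.

End spectral.

Section noise.
Context {R : realType} {d : nat} {O : polygonal_domain R d}.
Context (e : nat -> L2 O).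
Local Notation L2 := (L2 O).

Record is_covariance (Q : L2 -> L2) : Prop := {
  cov_linear : linearL2 Q ;
  cov_bounded : boundedL2 Q ;
  cov_symmetric : symmetricL2 Q ;
  cov_definite : forall u, ~ eqL2 u 0 -> 0 < ip (Q u) u ;
  cov_trace : (\sum_(0 <= i <oo) (ip (Q (e i)) (e i))%:E < +oo)%E
}.

Record is_sqrt_op (Q Qh : L2 -> L2) : Prop := {
  sqrt_op_linear : linearL2 Qh ;
  sqrt_op_bounded : boundedL2 Qh ;
  sqrt_op_symmetric : symmetricL2 Qh ;
  sqrt_op_nonneg : forall u, 0 <= ip (Qh u) u ;
  sqrt_op_sqr : forall u, eqL2 (Qh (Qh u)) (Q u)
}.

Context (Qh : L2 -> L2).

Definition hs_sum (G : L2 -> L2) : \bar R :=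
  (\sum_(0 <= i <oo) (norm2 (G (Qh (e i))) ^+ 2)%:E)%E.

Definition hs_norm (G : L2 -> L2) : R := Num.sqrt (fine (hs_sum G)).

(* Hilbert-Schmidt operators from Q^{1/2}(L^2), normed by
   ||Q^{1/2} u|| = ||u||_{L^2}, to L^2.  Values of G off the range of Q^{1/2}
   are irrelevant. *)
Record is_hilbert_schmidt (G : L2 -> L2) : Prop := {
  hs_linear : forall (a : R) u v z1 z2, eqL2 z1 (Qh u) -> eqL2 z2 (Qh v) ->
    eqL2 (G (a *: z1 + z2)) (a *: G z1 + G z2) ;
  hs_bounded : exists C : R, forall u z, eqL2 z (Qh u) ->
    norm2 (G z) <= C * norm2 u ;
  hs_finite : (hs_sum G < +oo)%E
}.

(* y = G dW where dW = sum_k b_k Q^{1/2} e_k with scalar increments b_k.  As G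
   is only defined on the range of Q^{1/2}, to which dW does not belong in
   general, G dW is the L^2(O)-sum of the b_k G (Q^{1/2} e_k). *)
Definition is_noise (G : L2 -> L2) (b : nat -> R) (y : L2) : Prop :=
  L2cvg (O := O) (fun n => (\sum_(k < n) b k *: G (Qh (e k)) : L2)) y.

End noise.

Section stochastic.
Context {R : realType} {dW : measure_display} {Om : measurableType dW}.
Context (P : probability Om R).

(* The time set is [0, +oo[; values at negative times are irrelevant. *)
Record is_filtration (F : R -> set (set Om)) : Prop := {
  filtration_sigma : forall t, 0 <= t -> sigma_algebra setT (F t) ;
  filtration_meas : forall t, 0 <= t -> F t `<=` measurable ;
  filtration_mono : forall s t, 0 <= s -> s <= t -> F s `<=` F t
}.

Definition measurable_wrt (G : set (set Om)) (X : Om -> R) : Prop :=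
  forall B : set R, measurable B -> G (X @^-1` B).

Definition sigma_gen (S : set (Om -> R)) : set (set Om) :=
  <<s [set A | exists X, S X /\ exists2 B : set R, measurable B & A = X @^-1` B] >>.

Definition indep2 (G H : set (set Om)) : Prop :=
  forall A B, G A -> H B -> P (A `&` B) = (P A * P B)%E.

Definition mutually_indep (G : nat -> set (set Om)) : Prop :=
  forall (J : seq nat) (A : nat -> set Om), uniq J ->
    (forall k, k \in J -> G k (A k)) ->
    P (\big[setI/setT]_(k <- J) A k) = (\prod_(k <- J) P (A k))%E.

Record is_iid_brownian (F : R -> set (set Om)) (beta : nat -> R -> Om -> R) :
    Prop := {
  bm_adapted : forall k t, 0 <= t -> measurable_wrt (F t) (beta k t) ;
  bm_start : forall k, {ae P, forall w, beta k 0 w = 0} ;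
  bm_continuous : forall k, {ae P, forall w,
    {within [set t | 0 <= t], continuous (fun t => beta k t w)}} ;
  bm_gaussian : forall k s t, 0 <= s -> s < t ->
    forall B : set R, measurable B ->
      P ((fun w => beta k t w - beta k s w) @^-1` B) =
      normal_prob 0 (Num.sqrt (t - s)) B ;
  bm_indep_past : forall s t, 0 <= s -> s <= t ->
    indep2 (F s) (sigma_gen [set X | exists k,
      X = (fun w => beta k t w - beta k s w)]) ;
  bm_indep : mutually_indep (fun k => sigma_gen [set X | exists t,
      0 <= t /\ X = beta k t])
}.

End stochastic.

Inductive scheme := Midpoint | ExponentialEuler.

Section schemes.
Context {R : realType} {d : nat} {O : polygonal_domain R d}.
Local Notation L2 := (L2 O).
Context (e : nat -> L2) (lam : nat -> R) (E : R -> L2 * L2 -> L2 * L2).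
Context (Qh : L2 -> L2).
Context (f : L2 -> L2) (g : L2 * ('I_d -> L2) -> L2 -> L2).
Context (Ft : R -> R) (delta0 : R).

Definition potential (u : L2) : R := \int[leb O]_x Ft (u x).

Definition sqrt_potential (u : L2) : R := Num.sqrt (potential u + delta0).

(* uhat_n; as 0.-1 = 0, the convention u_{-1} = u_0 is built in. *)
Definition uhat (extrapolated : bool) (u : nat -> L2) (n : nat) : L2 :=
  if extrapolated then (2^-1 : R) *: ((3 : R) *: u n - u n.-1) else u n.

Definition sav_drift (uh : L2) (q q' : R) : L2 :=
  ((q + q') / 2) *: ((sqrt_potential uh)^-1 *: f uh).

Definition q_step (uh u u' : L2) (q q' : R) : Prop :=
  q' = q + ip (f uh) (u' - u) / (2 * sqrt_potential uh).

(* y stands for g (Theta u_n) dW_n. *)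
Definition midpoint_step (tau : R) (uh u v u' v' : L2) (q q' : R) (y : L2) :
    Prop :=
  [/\ eqL2 u' (u + (tau / 2) *: (v + v') + (tau / 2) *: y),
      frac_dom e lam 1 (u + u') &
      eqL2 v' (v + (tau / 2) *: Lap e lam (u + u')
                 - tau *: sav_drift uh q q' + y)].

(* Z stands for A^{-1} (E(tau) - I) (0, - sav_drift). *)
Definition exponential_step (tau : R) (uh u v u' v' : L2) (q q' : R) (y : L2) :
    Prop :=
  let D : L2 * L2 := (0, - sav_drift uh q q') in
  exists Z : L2 * L2,
    [/\ wave_dom e lam Z,
        eqHH (wave_op e lam Z) (E tau D - D) &
        eqHH (u', v') (E tau (u, v) + Z + E tau (0, y))].

Definition scheme_step (s : scheme) :=
  match s with
  | Midpoint => midpoint_step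
  | ExponentialEuler => exponential_step
  end.

Context {dW : measure_display} {Om : measurableType dW}.
Context (P : probability Om R) (F : R -> set (set Om)).
Context (beta : nat -> R -> Om -> R).

Record is_numerical_solution (s : scheme) (extrapolated : bool) (u0 v0 : L2)
    (N : nat) (tau : R) (u v : nat -> Om -> L2) (q : nat -> Om -> R) :
    Prop := {
  sol_u0 : forall w, eqL2 (u 0%N w) u0 ;
  sol_v0 : forall w, eqL2 (v 0%N w) v0 ;
  sol_q0 : forall w, q 0%N w = sqrt_potential u0 ;
  sol_H1 : forall n w, (n <= N)%N -> Hdot e lam 1 (u n w) ;
  sol_u_adapted : forall n (h : L2), (n <= N)%N ->
    measurable_wrt (F (n%:R * tau)) (fun w => ip (u n w) h) ;
  sol_v_adapted : forall n (h : L2), (n <= N)%N ->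
    measurable_wrt (F (n%:R * tau)) (fun w => ip (v n w) h) ;
  sol_q_adapted : forall n, (n <= N)%N ->
    measurable_wrt (F (n%:R * tau)) (q n) ;
  sol_step : forall n, (n < N)%N -> {ae P, forall w,
    let uh := uhat extrapolated (fun m => u m w) n in
    q_step uh (u n w) (u n.+1 w) (q n w) (q n.+1 w) /\
    exists y : L2,
      is_noise e Qh (g (Theta (u n w)))
        (fun k => beta k (n.+1%:R * tau) w - beta k (n%:R * tau) w) y /\
      scheme_step s tau uh (u n w) (v n w) (u n.+1 w) (v n.+1 w)
        (q n w) (q n.+1 w) y}
}.

Definition energy (u v : L2) (q : R) : R :=
  2^-1 * normHdot e lam 1 u ^+ 2 + 2^-1 * norm2 v ^+ 2 + q ^+ 2.

End schemes.

Definition meval2 (R : realType) (b : mpoly.mpoly 2 R) (x y : R) : R :=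
  mpoly.meval (fun i : 'I_2 => if i == ord0 then x else y) b.

Definition total_degree (R : realType) (b : mpoly.mpoly 2 R) : nat :=
  \max_(m <- mpoly.msupp b) mpoly.mdeg m.

(* Main.v *)
From HB Require Import structures.
Require Import Defs.
From mathcomp Require Import all_boot all_order all_algebra.
From mathcomp Require Import all_classical all_reals all_analysis.
From mathcomp Require Import measurable_realfun ring lra.
From mathcomp Require mpoly.
Set Implicit Arguments.
Unset Strict Implicit.
Unset Printing Implicit Defensive.
Import Order.TTheory GRing.Theory Num.Theory.
Import numFieldNormedType.Exports.
Local Open Scope classical_set_scope.
Local Open Scope ring_scope.

(** Write V_n for V(u_n, v_n, q_n) and y_n for the noise g(Theta u_n) dW_n of the
    n-th step. Both schemes satisfy, almost surely, the exact energy balance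
      V_(n+1) = V_n + <v_n, y_n> + |y_n|^2 / 2                 ([energy_step]).
    Indeed, in each eigenmode of the Laplacian the exponential scheme is a
    rotation about the equilibrium of an oscillator under a constant force, and
    the midpoint scheme conserves quadratic energies, so both conserve the
    linear part of the energy of the state (u_n, v_n + y_n) up to the work of
    the nonlinear force ([exponential_balance], [midpoint_balance]); and the
    scalar variable q is updated precisely so that q^2 absorbs this work. As E
    is known only through its generator, the fact that it acts on each mode by a
    rotation has to be derived from it ([flow_rotation]).

    Given the past, y_n is a centred Gaussian vector, and by the linear growth of
    g its variance is at most C_0 tau (1 + V_n), with C_0 = 4 c_2^2. Put
    s = 1 + V_n, c = <v_n, y_n> / s and r = |y_n|^2 / s. Then
      (1 + V_(n+1))^(m+1) = s^(m+1) (1 + c + r / 2)^(m+1),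
    where c has mean zero and both c^2 and r have moments of the order of tau,
    with constants that do not depend on the state. Expanding the power gives
      E[(1 + V_(n+1))^(m+1)] <= (1 + K tau) E[(1 + V_n)^(m+1)]
    with K independent of tau ([frozen_increment], [expected_step]), and n tau <= T
    turns the product of these factors into the bound e^(K T)
    ([energy_moment]). A real exponent p is covered by an integer m + 1 >= p.

    Three points need care. Conditioning on the past is replaced by Tonelli's
    theorem on the product of the past and the future of the driving Brownian
    motions ([decoupling]). The noise is an infinite series, so the estimates
    are proved for finitely many Brownian motions, with constants that do not
    depend on their number, and passed to the limit by Fatou's lemma. Finally the
    coefficients g(Theta u_n) must be random variables known at time t_n; this
    follows from the local Lipschitz continuity of g, because a locally Lipschitz
    function of the state is a limit of continuous functions of finitely many of
    its coordinates ([measurable_lipschitz]). *)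

(** * Limits *)

Lemma cvg_of_bound (R : realType) (T : Type) (F : set_system T) {FF : ProperFilter F}
  (a b : T -> R) (l : R) :
  (forall t, `|a t - l| <= b t) -> b t @[t --> F] --> 0 ->
  a t @[t --> F] --> l.
Proof.
move=> ab b0; apply/cvgrPdist_le => e e0.
move/cvgrPdist_le : b0 => /(_ e e0); apply: filterS => t.
rewrite sub0r normrN distrC => h; apply: le_trans (ab t) _.
exact: le_trans (ler_norm _) h.
Qed.

Lemma cvg_mul0 (R : realType) (T : Type) (F : set_system T) {FF : Filter F}
  (C : R) (a : T -> R) : a t @[t --> F] --> 0 -> C * a t @[t --> F] --> 0.
Proof.
by move=> a0; rewrite -[X in _ --> X](mulr0 C); apply: cvgM => //; exact: cvg_cst.
Qed.

Lemma cvg_expn (R : realType) (T : Type) (F : set_system T) {FF : Filter F}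
  (f : T -> R) (l : R) n :
  f t @[t --> F] --> l -> f t ^+ n @[t --> F] --> l ^+ n.
Proof.
move=> fl; elim: n => [|n IHn]; first by under eq_fun do rewrite expr0; exact: cvg_cst.
by under eq_fun do rewrite exprS; rewrite exprS; exact: cvgM.
Qed.

Lemma cvg_sumr (R : realType) (T I : Type) (F : set_system T) {FF : Filter F}
  (r : seq I) (f : I -> T -> R) (l : I -> R) :
  (forall i, f i t @[t --> F] --> l i) ->
  \sum_(i <- r) f i t @[t --> F] --> \sum_(i <- r) l i.
Proof.
move=> fl; elim: r => [|i r IHr].
  by under eq_fun do rewrite big_nil; rewrite big_nil; exact: cvg_cst.
by under eq_fun do rewrite big_cons; rewrite big_cons; exact: cvgD.
Qed.

Lemma cvg_continuous (R : realType) (T : Type) (F : set_system T) {FF : Filter F}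
  (h : R -> R) (f : T -> R) (l : R) : continuous h ->
  f t @[t --> F] --> l -> h (f t) @[t --> F] --> h l.
Proof. by move=> ch; apply: continuous_cvg; exact: ch. Qed.

(** * The inner product of square integrable functions *)

Section inner_product.
Context {R : realType} {d : nat} {O : polygonal_domain R d}.
Local Notation L2 := (L2 O).
Implicit Types u v w : L2.

Lemma integrable_mulL2 u v :
  (leb O).-integrable setT (EFin \o (fun x => u x * v x)).
Proof. by apply/Lfun1_integrable/Lfun2_mul_Lfun1; exact: LfunP. Qed.

Lemma ipC u v : ip u v = ip v u.
Proof. by rewrite /ip; apply: eq_Rintegral => x _; rewrite mulrC. Qed.

Lemma ipDl u v w : ip (u + v) w = ip u w + ip v w.
Proof.
rewrite /ip -RintegralD//; try exact: integrable_mulL2.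
by apply: eq_Rintegral => x _; rewrite -mulrDl.
Qed.

Lemma ipZl a u v : ip (a *: u) v = a * ip u v.
Proof.
rewrite /ip -RintegralZl//; last exact: integrable_mulL2.
by apply: eq_Rintegral => x _; rewrite mulrA.
Qed.

Lemma ip_ge0 u : 0 <= ip u u.
Proof. by apply: Rintegral_ge0 => x _; rewrite -expr2 sqr_ge0. Qed.

Lemma sqr_norm2 u : norm2 u ^+ 2 = ip u u.
Proof. by rewrite sqr_sqrtr// ip_ge0. Qed.

Lemma ip_congr u u' v v' : eqL2 u u' -> eqL2 v v' -> ip u v = ip u' v'.
Proof.
move=> uu' vv'; rewrite /ip /Rintegral; congr fine.
apply: ae_eq_integral => //.
- exact: measurable_int (integrable_mulL2 u v).
- exact: measurable_int (integrable_mulL2 u' v').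
- by apply: filterS2 uu' vv' => x -> ->.
Qed.

Lemma ipE u : (ip u u)%:E = (\int[leb O]_x ((u x) ^+ 2)%:E)%E.
Proof.
rewrite /ip /Rintegral fineK; last first.
  exact: integrable_fin_num (integrable_mulL2 u u).
by apply: eq_integral => x _; rewrite expr2.
Qed.

Lemma ip_eq0 u : ip u u = 0 -> eqL2 u 0.
Proof.
move=> u0; have h : (ip u u)%:E = 0%E by rewrite u0.
rewrite ipE in h.
have : ae_eq (leb O) setT (fun x => ((u x) ^+ 2)%:E) (cst 0%E).
  apply/(ae_eq_integral_abs (leb O) measurableT).
    have := measurable_int _ (integrable_mulL2 u u).
    by apply: eq_measurable_fun => x _ /=; rewrite expr2.
  rewrite -[RHS]h; apply: eq_integral => x _.
  by rewrite gee0_abs// lee_fin sqr_ge0.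
apply: filterS => x /= /(_ I) [] /eqP; rewrite sqrf_eq0 => /eqP ->.
by [].
Qed.

Lemma eqL2P u v : eqL2 u v <-> ip (u - v) (u - v) = 0.
Proof.
split=> [uv|/ip_eq0]; last first.
  by apply: filterS => x h; apply/eqP; rewrite -subr_eq0; apply/eqP.
have uv0 : eqL2 (u - v) 0.
  by apply: filterS uv => x h; apply/eqP; rewrite subr_eq0; apply/eqP.
by rewrite (ip_congr uv0 uv0) -(scale0r 0) ipZl mul0r.
Qed.

(** Makes the norm available for the notion of convergence that expresses
    eigenfunction expansions and the noise. *)
Lemma L2cvgP (v : nat -> L2) w :
  L2cvg (O := O) (fun n => v n) w <->
  norm2 (v n - w) @[n --> \oo] --> 0.
Proof.
have E n : (\int[leb O]_x ((v n x - w x) ^+ 2)%:E)%E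
    = ((norm2 (v n - w)) ^+ 2)%:E.
  rewrite sqr_norm2 ipE; exact: eq_integral.
rewrite /L2cvg (_ : (fun n => _) = (fun n => ((norm2 (v n - w)) ^+ 2)%:E));
  last by apply/funext => n; rewrite E.
split => [/fine_cvg h|h].
  have {}h : norm2 (v n - w) ^+ 2 @[n --> \oo] --> (0 : R) by exact: h.
  rewrite -(sqrtr0 R).
  rewrite (_ : (fun n => _) = (fun n => Num.sqrt (norm2 (v n - w) ^+ 2))).
    by apply: continuous_cvg h; exact: sqrt_continuous.
  by apply/funext => n; rewrite sqrtr_sqr ger0_norm ?sqrtr_ge0.
apply: cvg_EFin; first exact: nearW.
rewrite (_ : _ \o _ = (fun n => norm2 (v n - w) * norm2 (v n - w)))//.
by rewrite -[X in _ --> X](mul0r 0); exact: cvgM.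
Qed.

End inner_product.

(** * Hilbert spaces with an eigenbasis *)

(** What the argument needs of L^2(O) and of the Dirichlet Laplacian, with
    [pow s] for the power (-Lambda)^s. The inner product is only semidefinite:
    square integrable functions are not identified when they agree almost
    everywhere, and having the same coordinates in the eigenbasis takes the
    place of equality. *)
Structure spectral (R : realType) := Spectral {
  space :> lmodType R ;
  dot : space -> space -> R ;
  eig : nat -> space ;
  eigval : nat -> R ;
  pow : R -> space -> space ;
  dotC : forall x y, dot x y = dot y x ;
  dotDl : forall x y z, dot (x + y) z = dot x z + dot y z ;
  dotZl : forall a x y, dot (a *: x) y = a * dot x y ;
  dot_ge0 : forall x, 0 <= dot x x ;
  eigval_gt0 : forall i, 0 < eigval i ;
  eig_orthonormal : forall i j, dot (eig i) (eig j) = (i == j)%:R ;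
  eig_complete : forall x,
    Num.sqrt (dot (\sum_(i < n) dot x (eig i) *: eig i - x)
                  (\sum_(i < n) dot x (eig i) *: eig i - x))
      @[n --> \oo] --> (0 : R) ;
  powP : forall s x,
    (exists y, Num.sqrt
      (dot (\sum_(i < n) (eigval i `^ s * dot x (eig i)) *: eig i - y)
           (\sum_(i < n) (eigval i `^ s * dot x (eig i)) *: eig i - y))
      @[n --> \oo] --> (0 : R)) ->
    Num.sqrt
      (dot (\sum_(i < n) (eigval i `^ s * dot x (eig i)) *: eig i - pow s x)
           (\sum_(i < n) (eigval i `^ s * dot x (eig i)) *: eig i - pow s x))
      @[n --> \oo] --> (0 : R)
}.

Section hilbert.
Context {R : realType} {H : spectral R}.
Implicit Types (x y z u v w : H) (c : nat -> R) (s a : R).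

Definition norm x := Num.sqrt (dot x x).

Definition coord x i := dot x (eig H i).

Definition modes c n : H := \sum_(i < n) c i *: eig H i.

Definition is_pow s x y :=
  norm (modes (fun i => eigval H i `^ s * coord x i) n - y)
    @[n --> \oo] --> (0 : R).

Definition pow_dom s x := exists y, is_pow s x y.

Lemma dotDr u v w : dot w (u + v) = dot w u + dot w v.
Proof. by rewrite dotC dotDl !(dotC w). Qed.

Lemma dotZr a u v : dot u (a *: v) = a * dot u v.
Proof. by rewrite dotC dotZl dotC. Qed.

Lemma dot0l v : dot 0 v = 0.
Proof. by rewrite -(scale0r v) dotZl mul0r. Qed.

Lemma dotNl u v : dot (- u) v = - dot u v.
Proof. by rewrite -scaleN1r dotZl mulN1r. Qed.

Lemma dotNr u v : dot u (- v) = - dot u v.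
Proof. by rewrite dotC dotNl dotC. Qed.

Lemma dotBl u v w : dot (u - v) w = dot u w - dot v w.
Proof. by rewrite dotDl dotNl. Qed.

Lemma dotBr u v w : dot w (u - v) = dot w u - dot w v.
Proof. by rewrite dotDr dotNr. Qed.

Lemma dot_suml (I : Type) (r : seq I) (P : pred I) (F : I -> H) v :
  dot (\sum_(i <- r | P i) F i) v = \sum_(i <- r | P i) dot (F i) v.
Proof.
by apply: (big_morph (fun u => dot u v)) => [x y|]; rewrite ?dotDl ?dot0l.
Qed.

Lemma dot_sumr (I : Type) (r : seq I) (P : pred I) (F : I -> H) v :
  dot v (\sum_(i <- r | P i) F i) = \sum_(i <- r | P i) dot v (F i).
Proof. by rewrite dotC dot_suml; apply: eq_bigr => i _; rewrite dotC. Qed.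

Lemma norm_ge0 u : 0 <= norm u. Proof. exact: sqrtr_ge0. Qed.

Lemma norm0 : norm (0 : H) = 0.
Proof. by rewrite /norm dot0l sqrtr0. Qed.

Lemma sqr_norm u : norm u ^+ 2 = dot u u.
Proof. by rewrite sqr_sqrtr// dot_ge0. Qed.

Lemma dot_sqr_le u v : dot u v ^+ 2 <= dot u u * dot v v.
Proof.
have [v0|v0] := eqVneq (dot v v) 0; last first.
  have vp : 0 < dot v v by rewrite lt_neqAle eq_sym v0 dot_ge0.
  have := dot_ge0 (dot v v *: u - dot u v *: v).
  rewrite dotBl !dotBr !dotZl !dotZr (dotC v u) => h.
  rewrite -subr_ge0 -(pmulr_rge0 _ vp); apply: le_trans h _.
  by rewrite le_eqVlt; apply/orP; left; apply/eqP; ring.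
(* if v is null then 0 <= |u|^2 + 2 t (u, v) for every t *)
have [->|uv0] := eqVneq (dot u v) 0; first by rewrite v0 mulr0 expr0n.
have := dot_ge0 (u - ((dot u u + 1) / (2 * dot u v)) *: v).
rewrite dotBl !dotBr !dotZl !dotZr (dotC v u) v0.
rewrite (_ : _ - _ = -1); first lra.
by field; rewrite uv0.
Qed.

Lemma dot_le_norm u v : `|dot u v| <= norm u * norm v.
Proof.
rewrite -(ler_pXn2r (n := 2))// ?nnegrE ?normr_ge0//; last first.
  by rewrite mulr_ge0// norm_ge0.
by rewrite real_normK ?num_real// exprMn !sqr_norm dot_sqr_le.
Qed.

Lemma normD u v : norm (u + v) <= norm u + norm v.
Proof.
rewrite -(ler_pXn2r (n := 2))// ?nnegrE ?addr_ge0 ?norm_ge0//.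
rewrite sqrrD !sqr_norm dotDl !dotDr (dotC v u).
have := ler_norm (dot u v); have := dot_le_norm u v.
rewrite -mulr_natl; nra.
Qed.

Lemma normZ a u : norm (a *: u) = `|a| * norm u.
Proof.
by rewrite /norm dotZl dotZr mulrA -expr2 sqrtrM ?sqr_ge0// sqrtr_sqr.
Qed.

Lemma normN u : norm (- u) = norm u.
Proof. by rewrite -scaleN1r normZ normrN1 mul1r. Qed.

Lemma normB u v : norm (u - v) <= norm u + norm v.
Proof. by rewrite -(normN v) normD. Qed.

Lemma dot_sqrD u v : dot (u + v) (u + v) = dot u u + 2 * dot u v + dot v v.
Proof. by rewrite dotDl !dotDr (dotC v u); ring. Qed.

Lemma cvg_dot (v : nat -> H) w z :
  norm (v n - w) @[n --> \oo] --> 0 -> dot (v n) z @[n --> \oo] --> dot w z.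
Proof.
move=> h; apply: (cvg_of_bound (b := fun n => norm (v n - w) * norm z)).
  by move=> n; rewrite -dotBl dot_le_norm.
by rewrite -(mul0r (norm z)); apply: cvgMl.
Qed.

Lemma cvg_norm (v : nat -> H) w :
  norm (v n - w) @[n --> \oo] --> 0 -> norm (v n) @[n --> \oo] --> norm w.
Proof.
move=> h; apply: (cvg_of_bound (b := fun n => norm (v n - w))) => // n.
rewrite ler_norml; apply/andP; split.
  have := normB (v n) (v n - w); rewrite subKr; lra.
by have := normD (v n - w) w; rewrite subrK; lra.
Qed.

Lemma coordD x y i : coord (x + y) i = coord x i + coord y i.
Proof. exact: dotDl. Qed.

Lemma coordZ a x i : coord (a *: x) i = a * coord x i.
Proof. exact: dotZl. Qed.

Lemma coordN x i : coord (- x) i = - coord x i.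
Proof. exact: dotNl. Qed.

Lemma coordB x y i : coord (x - y) i = coord x i - coord y i.
Proof. exact: dotBl. Qed.

Lemma coord0 i : coord 0 i = 0.
Proof. exact: dot0l. Qed.

Definition coordE := (coordB, coordN, coordD, coordZ, coord0).

Lemma dot_modes c n x : dot (modes c n) x = \sum_(i < n) c i * coord x i.
Proof.
by rewrite dot_suml; apply: eq_bigr => i _; rewrite dotZl (dotC (eig H i)).
Qed.

Lemma coord_modes c n j : coord (modes c n) j = if (j < n)%N then c j else 0.
Proof.
rewrite /coord dot_modes; under eq_bigr do rewrite /coord eig_orthonormal.
case: ifPn => [jn|]; last first.
  rewrite -leqNgt => nj; rewrite big1// => i _.
  by rewrite gtn_eqF ?mulr0// (leq_trans (ltn_ord i)).
rewrite (bigD1 (Ordinal jn))//= eqxx mulr1 big1 ?addr0// => i ij.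
suff -> : (j == i :> nat) = false by rewrite mulr0.
by apply: contraNF ij => /eqP ij; apply/eqP/val_inj.
Qed.

Lemma modes_coord c y j :
  norm (modes c n - y) @[n --> \oo] --> 0 -> coord y j = c j.
Proof.
move=> /(cvg_dot (z := eig H j)) h; apply: (cvg_unique _ h) => //.
apply: cvg_near_cst; exists j.+1 => // n /= jn.
by rewrite -/(coord _ _) coord_modes jn.
Qed.

Lemma modes_cvg x : norm (modes (coord x) n - x) @[n --> \oo] --> 0.
Proof. exact: eig_complete. Qed.

Lemma parseval x y :
  \sum_(i < n) coord x i * coord y i @[n --> \oo] --> dot x y.
Proof.
have := cvg_dot (z := y) (modes_cvg x).
by under eq_fun do rewrite dot_modes.
Qed.

Lemma dot_limE x y r :
  \sum_(i < n) coord x i * coord y i @[n --> \oo] --> r -> dot x y = r.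
Proof. by move=> h; apply: (cvg_unique _ (@parseval x y) h). Qed.

Lemma dot_coord x y x' y' : coord x =1 coord x' -> coord y =1 coord y' ->
  dot x y = dot x' y'.
Proof.
move=> xx' yy'; apply: dot_limE.
by under eq_fun do under eq_bigr do rewrite xx' yy'; exact: parseval.
Qed.

Lemma norm_coord x y : coord x =1 coord y -> norm x = norm y.
Proof. by move=> xy; rewrite /norm (dot_coord xy xy). Qed.

Lemma coord_eqP x y : dot (x - y) (x - y) = 0 <-> coord x =1 coord y.
Proof.
split => [xy i|xy]; last first.
  by rewrite (@dot_coord _ _ 0 0) ?dot0l// => i; rewrite !coordE xy subrr.
apply/eqP; rewrite -subr_eq0 -coordB -sqrf_eq0 eq_le sqr_ge0 andbT.
by rewrite (le_trans (dot_sqr_le _ _))// xy mul0r.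
Qed.

Lemma bessel x n : \sum_(i < n) coord x i ^+ 2 <= dot x x.
Proof.
pose y := modes (coord x) n.
have yx : dot y x = \sum_(i < n) coord x i ^+ 2.
  by rewrite dot_modes; apply: eq_bigr => i _; rewrite expr2.
have yy : dot y y = \sum_(i < n) coord x i ^+ 2.
  rewrite {1}/y dot_modes; apply: eq_bigr => i _.
  by rewrite coord_modes ltn_ord expr2.
have := dot_ge0 (y - x); rewrite dotBl !dotBr (dotC x) yx yy; lra.
Qed.

Lemma is_pow_coord s x y j :
  is_pow s x y -> coord y j = eigval H j `^ s * coord x j.
Proof. by move=> /modes_coord. Qed.

Lemma coord_pow s x i : pow_dom s x ->
  coord (pow s x) i = eigval H i `^ s * coord x i.
Proof. by move=> hx; apply: is_pow_coord; exact: powP hx. Qed.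

Lemma is_pow_congr s x y z : coord x =1 coord y -> is_pow s x z -> is_pow s y z.
Proof.
move=> xy; rewrite /is_pow.
by under eq_fun do under eq_fun do rewrite xy.
Qed.

Lemma pow_dom_congr s x y : coord x =1 coord y -> pow_dom s x -> pow_dom s y.
Proof. by move=> xy [z xz]; exists z; exact: is_pow_congr xz. Qed.

Lemma pow_dom_lin s a x y : pow_dom s x -> pow_dom s y ->
  pow_dom s (a *: x + y).
Proof.
move=> [x' xx'] [y' yy']; exists (a *: x' + y').
apply: (cvg_of_bound (b := fun n =>
  `|a| * norm (modes (fun i => eigval H i `^ s * coord x i) n - x') +
  norm (modes (fun i => eigval H i `^ s * coord y i) n - y'))); last first.
  rewrite -[X in _ --> X]addr0 -[X in _ --> X + _](mulr0 `|a|).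
  by apply: cvgD => //; exact: cvgMr.
move=> n; rewrite subr0 ger0_norm ?norm_ge0// -normZ.
apply: le_trans (normD _ _); rewrite le_eqVlt; apply/orP; left; apply/eqP.
apply: norm_coord => i; rewrite !coordE !coord_modes !coordE.
by case: ifP => _; ring.
Qed.

Lemma pow_dom0 s : pow_dom s 0.
Proof.
exists 0; apply: cvg_near_cst; apply: nearW => n.
rewrite subr0 /modes big1 ?norm0// => i _; by rewrite coord0 mulr0 scale0r.
Qed.

Lemma pow_domD s x y : pow_dom s x -> pow_dom s y -> pow_dom s (x + y).
Proof. by move=> hx hy; rewrite -[x]scale1r; exact: pow_dom_lin. Qed.

Lemma pow_domZ s a x : pow_dom s x -> pow_dom s (a *: x).
Proof.
by move=> hx; have := pow_dom_lin a hx (pow_dom0 s); rewrite addr0.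
Qed.

Lemma pow_domB s x y : pow_dom s x -> pow_dom s y -> pow_dom s (x - y).
Proof.
by move=> hx /(pow_domZ (-1)); rewrite scaleN1r; exact: pow_domD.
Qed.

Lemma modes_pow s c n :
  is_pow s (modes c n) (modes (fun i => eigval H i `^ s * c i) n).
Proof.
apply: cvg_near_cst; exists n => // N /= nN.
rewrite -norm0; apply: norm_coord => j.
rewrite !coordE !coord_modes; case: (ltnP j n) => jn.
  by rewrite (leq_trans jn nN) subrr.
by case: ifP => _; rewrite ?mulr0 subr0.
Qed.

Lemma modes_pow_dom s c n : pow_dom s (modes c n).
Proof. by eexists; exact: modes_pow. Qed.

Lemma pow_half i : eigval H i `^ (1 / 2) * eigval H i `^ (1 / 2) = eigval H i.
Proof.
rewrite -powRD; last by rewrite gt_eqF ?implybT ?eigval_gt0.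
by rewrite (_ : 1 / 2 + 1 / 2 = 1) ?powRr1 ?ltW ?eigval_gt0//; field.
Qed.

(** Parseval's identity, the factors [eigval H i `^ (1 / 2)] of both arguments
    being multiplied. *)
Lemma dot_pow x y : pow_dom (1 / 2) x -> pow_dom (1 / 2) y ->
  \sum_(i < n) eigval H i * (coord x i * coord y i) @[n --> \oo] -->
    dot (pow (1 / 2) x) (pow (1 / 2) y).
Proof.
move=> hx hy; have := @parseval (pow (1 / 2) x) (pow (1 / 2) y).
under eq_fun do under eq_bigr do
  rewrite !coord_pow// mulrACA pow_half.
by [].
Qed.

Lemma norm_sqrB_le x y :
  norm (x - y) ^+ 2 <= 2 * (norm x ^+ 2 + norm y ^+ 2).
Proof.
rewrite !sqr_norm; have := dot_ge0 (x + y).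
rewrite !(dotBl, dotBr, dotDl, dotDr) (dotC y x); lra.
Qed.

Lemma norm_pow_congr r x y :
  pow_dom r y -> coord x =1 coord y -> norm (pow r x) = norm (pow r y).
Proof.
move=> hy xy; have hx : pow_dom r x by apply: pow_dom_congr hy => i; rewrite xy.
by apply: norm_coord => i; rewrite !coord_pow// xy.
Qed.

(** The energy that a kick [y] adds to a state of velocity [v] is continuous in
    [y], so the balance of a step can be read on truncations of the noise. *)
Lemma kinetic_gain_cvg s v y (Y : nat -> H) :
  norm (Y n - y) @[n --> \oo] --> 0 ->
  s + dot v (Y n) + dot (Y n) (Y n) / 2 @[n --> \oo] -->
    s + dot v y + dot y y / 2.
Proof.
move=> lim; apply: cvgD.
  apply: cvgD; first exact: cvg_cst.
  rewrite dotC; under eq_fun do rewrite dotC.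
  exact: cvg_dot.
apply: cvgM; last exact: cvg_cst.
rewrite -sqr_norm; under eq_fun do rewrite -sqr_norm.
by apply: cvg_expn; exact: cvg_norm.
Qed.

End hilbert.

Section instance.
Context {R : realType} {d : nat} {O : polygonal_domain R d}.
Local Notation L2 := (L2 O).
Context (e : nat -> L2) (lam : nat -> R).

Lemma is_fracP s x y : is_frac e lam s x y <->
  norm2 (\sum_(i < n) (lam i `^ s * ip x (e i)) *: e i - y)
    @[n --> \oo] --> (0 : R).
Proof. exact: L2cvgP. Qed.

Lemma fracP s x :
  (exists y, norm2 (\sum_(i < n) (lam i `^ s * ip x (e i)) *: e i - y)
    @[n --> \oo] --> (0 : R)) ->
  norm2 (\sum_(i < n) (lam i `^ s * ip x (e i)) *: e i - Defs.frac e lam s x)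
    @[n --> \oo] --> (0 : R).
Proof.
move=> [y /is_fracP xy]; apply/is_fracP.
by rewrite /Defs.frac; case: xgetP => [z _ //|/(_ y)].
Qed.

Context (e_lam : dirichlet_eigenbasis e lam).

Definition L2_spectral : spectral R :=
  @Spectral R L2 (@ip R d O) e lam (Defs.frac e lam) (@ipC _ _ _) (@ipDl _ _ _)
    (@ipZl _ _ _) (@ip_ge0 _ _ _) (Defs.eigval_gt0 e_lam)
    (Defs.eigvec_orthonormal e_lam)
    (fun x => (L2cvgP _ _).1 (Defs.eigvec_basis e_lam x)) fracP.

Lemma frac_domP s (x : L2) :
  Defs.frac_dom e lam s x <-> pow_dom (H := L2_spectral) s x.
Proof. by split=> -[y xy]; exists y; [exact/is_fracP|exact/is_fracP]. Qed.

Lemma eqL2_coord (x y : L2) :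
  eqL2 x y <-> coord (H := L2_spectral) x =1 coord (H := L2_spectral) y.
Proof.
split; first by move/eqL2P/(coord_eqP (H := L2_spectral)).
by move/(coord_eqP (H := L2_spectral))/eqL2P.
Qed.

End instance.

(** * Independence *)

Section decoupling.
Context {R : realType} {dW : measure_display} {Om : measurableType dW}.
Context (P : probability Om R).
Local Open Scope ereal_scope.

(** Independence makes the law of [(X, Y)] a product measure, so Tonelli's
    theorem applies: averaging over [Y] with [X] frozen plays the role of the
    conditional expectation given [X]. *)
Lemma decoupling d1 d2 (T1 : measurableType d1) (T2 : measurableType d2)
    (X : Om -> T1) (Y : Om -> T2) (Phi : T1 * T2 -> \bar R) :
  measurable_fun setT X -> measurable_fun setT Y ->
  (forall A B, measurable A -> measurable B ->
    P (X @^-1` A `&` Y @^-1` B) = P (X @^-1` A) * P (Y @^-1` B)) ->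
  measurable_fun setT Phi -> (forall z, 0 <= Phi z) ->
  measurable_fun setT (fun w => \int[P]_w' Phi (X w, Y w')) /\
  \int[P]_w Phi (X w, Y w) = \int[P]_w \int[P]_w' Phi (X w, Y w').
Proof.
move=> mX mY XY mPhi Phi0.
have mZ : measurable_fun setT (fun w => (X w, Y w)).
  exact/measurable_fun_pairP.
pose fX : {mfun Om >-> T1} := HB.pack X (isMeasurableFun.Build _ _ _ _ _ mX).
pose fY : {mfun Om >-> T2} := HB.pack Y (isMeasurableFun.Build _ _ _ _ _ mY).
pose fZ : {mfun Om >-> (T1 * T2)%type} :=
  HB.pack (fun w => (X w, Y w)) (isMeasurableFun.Build _ _ _ _ _ mZ).
have inner x : \int[distribution P fY]_y Phi (x, y) = \int[P]_w' Phi (x, Y w').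
  by rewrite ge0_integral_distribution//; exact/measurableT_comp.
have mF : measurable_fun setT (fun x => \int[P]_w' Phi (x, Y w')).
  have : measurable_fun setT (fubini_F (distribution P fY) Phi).
    exact: measurable_fun_fubini_tonelli_F.
  by apply: eq_measurable_fun => x _; rewrite /fubini_F inner.
split; first exact: (measurableT_comp mF mX).
rewrite -[LHS](ge0_integral_distribution fZ)//.
rewrite (eq_measure_integral (distribution P fX \x distribution P fY)); last first.
  by move=> A mA _; apply/esym/product_measure_unique.
rewrite (fubini_tonelli1 Phi)// /fubini_F.
under eq_integral do rewrite inner.
rewrite ge0_integral_distribution// => x; exact: integral_ge0.
Qed.

Lemma sigma_algebra_idE (G : set (set Om)) : sigma_algebra setT G -> <<s G >> = G.
Proof. exact: smallest_id. Qed.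

(** The identity of [Om], seen as a map to [Om] with a smaller sigma-algebra, is
    the random variable that carries all the information of this
    sigma-algebra. *)
Lemma decoupling_sigma (G H : set (set Om))
    (Phi : g_sigma_algebraType G * g_sigma_algebraType H -> \bar R) :
  <<s G >> `<=` measurable -> <<s H >> `<=` measurable ->
  indep2 P <<s G >> <<s H >> ->
  measurable_fun setT Phi -> (forall z, 0 <= Phi z) ->
  measurable_fun [set: Om] (fun w => \int[P]_w' Phi (w, w')) /\
  \int[P]_w Phi (w, w) = \int[P]_w \int[P]_w' Phi (w, w').
Proof.
move=> mG mH GH mPhi Phi0.
apply: (@decoupling _ _ (g_sigma_algebraType G) (g_sigma_algebraType H) id id) => //.
- by move=> _ A GA; rewrite setTI; exact: mG.
- by move=> _ A HA; rewrite setTI; exact: mH.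
Qed.

(** The finite intersections of events of the first [k] families form a
    pi-system that generates their joint sigma-algebra, and on this pi-system
    the product rule is a case of mutual independence. *)
Lemma mutually_indep_past (G : nat -> set (set Om)) k :
  (forall i, sigma_algebra setT (G i)) -> (forall i, G i `<=` measurable) ->
  mutually_indep P G ->
  indep2 P <<s [set A | exists2 i, (i < k)%N & G i A] >> (G k).
Proof.
move=> sG mG indep A B + GB.
pose Pi := [set A | exists2 F : nat -> set Om, (forall i, G i (F i)) &
  A = \big[setI/setT]_(i <- iota 0 k) F i].
have GT i : G i setT.
  by have [s0 sC _] := sG i; rewrite -(setD0 setT); exact: sC.
have GI i : setI_closed (G i).
  move=> C D; rewrite -(sigma_algebra_idE (sG i)).
  exact: (@measurableI _ (g_sigma_algebraType (G i))).
have PiI : setI_closed Pi.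
  move=> _ _ [C GC ->] [D GD ->]; exists (fun i => C i `&` D i).
    by move=> i; exact: GI.
  by rewrite big_split.
have Pim : Pi `<=` measurable.
  move=> _ [C GC ->]; apply: bigsetI_measurable => i _; exact: mG.
have PiT : Pi setT by exists (fun=> setT) => //; rewrite big1.
have sub : <<s [set A | exists2 i, (i < k)%N & G i A] >> `<=` <<s Pi >>.
  apply: smallest_sub; first exact: smallest_sigma_algebra.
  move=> C [i ik GC]; apply: sub_sigma_algebra.
  exists (fun j => if j == i then C else setT).
    by move=> j; case: eqP => [->|].
  rewrite (bigD1_seq i)/= ?iota_uniq ?mem_iota//= eqxx big1 ?setIT// => j.
  by move=> /negbTE ->.
move=> /sub sA.
have mB : measurable B by exact: mG GB.
have PB0 : (0 <= fine (P B))%R by rewrite fine_ge0.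
have mul C : mscale (NngNum PB0) P C = P C * P B.
  by rewrite /mscale/= fineK ?fin_num_measure// muleC.
rewrite -mul.
have -> : P (A `&` B) = mrestr P mB A by [].
apply: (g_sigma_algebra_measure_unique Pi _ (fun=> setT)) => //.
- by rewrite bigcup_const.
- move=> _ [C GC ->].
  apply: etrans (esym (mul _)).
  pose D i := if i == k then B else C i.
  have DC : \big[setI/setT]_(i <- iota 0 k) D i = \big[setI/setT]_(i <- iota 0 k) C i.
    apply: eq_big_seq => i; rewrite mem_iota /D => /andP[_ ik].
    by rewrite ltn_eqF.
  have [GD Dk] : (forall i, G i (D i)) /\ D k = B.
    by rewrite /D eqxx; split=> // i; case: eqP => [->|].
  have uk : uniq (rcons (iota 0 k) k).
    by rewrite rcons_uniq mem_iota ltnn andbF iota_uniq.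
  have := indep _ D uk (fun i _ => GD i).
  rewrite !big_rcons/= DC Dk.
  by rewrite -(indep _ D (iota_uniq 0 k) (fun i _ => GD i)) DC.
- by move=> _; rewrite /mrestr/= (le_lt_trans (probability_le1 _ _)) ?ltry//;
  exact: measurableI.
Qed.

End decoupling.

(** * Gaussian variables *)

Section gaussian.
Context {R : realType}.
Local Open Scope ereal_scope.

(** [normal_prob] is the integral of its density, which is therefore its
    Radon-Nikodym derivative up to a null set. *)
Lemma integral_normal_density (s : R) (f : R -> \bar R) :
  measurable_fun setT f -> (forall x, 0 <= f x) ->
  \int[normal_prob 0 s]_x f x =
  \int[lebesgue_measure]_x (f x * (normal_pdf 0 s x)%:E).
Proof.
move=> mf f0.
have dom := normal_prob_dominates (0:R) s.
rewrite -(Radon_Nikodym_SigmaFinite.change_of_variables dom)//.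
have mD : measurable_fun setT (Radon_Nikodym_SigmaFinite.f (normal_prob 0 s) lebesgue_measure).
  exact: measurable_int (Radon_Nikodym_SigmaFinite.f_integrable dom).
apply: ae_eq_integral => //.
- exact: emeasurable_funM.
- apply: emeasurable_funM => //; apply/measurable_EFinP.
  exact: measurable_normal_pdf.
apply: ae_eqe_mul2l; apply: integral_ae_eq => //.
- exact: Radon_Nikodym_SigmaFinite.f_integrable.
- by apply/measurable_EFinP; exact: measurable_normal_pdf.
- by move=> A _ mA; rewrite -Radon_Nikodym_SigmaFinite.f_integral.
Qed.

(** Completing the square turns the integrand into a multiple of the normal
    density of mean [a * s ^+ 2]. *)
Lemma normal_mgf (s a : R) : s != 0%R ->
  \int[normal_prob 0 s]_x (expR (a * x))%:E = (expR (a ^+ 2 * s ^+ 2 / 2))%:E.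
Proof.
move=> s0; rewrite integral_normal_density//; last first.
  by apply/measurable_EFinP/measurableT_comp.
have E x : (expR (a * x))%:E * (normal_pdf 0 s x)%:E =
    (expR (a ^+ 2 * s ^+ 2 / 2))%:E * (normal_pdf (a * s ^+ 2) s x)%:E.
  have pdfE y : normal_pdf y s x = (normal_peak s * normal_fun y s x)%R.
    by rewrite normal_pdfE.
  rewrite -!EFinM !pdfE mulrCA [in RHS]mulrCA /normal_fun -!expRD.
  by congr (_ * expR _)%:E; rewrite -mulr_natr; field.
under eq_integral do rewrite E.
rewrite ge0_integralZl//; last 2 first.
- by apply/measurable_EFinP; exact: measurable_normal_pdf.
- by move=> x _; rewrite lee_fin normal_pdf_ge0.
by rewrite integral_normal_pdf mule1.
Qed.

Context {dW : measure_display} {Om : measurableType dW} (P : probability Om R).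

Lemma gaussian_mgf (s a : R) (b : Om -> R) : s != 0%R -> measurable_fun setT b ->
  (forall B : set R, measurable B -> P (b @^-1` B) = normal_prob 0 s B) ->
  \int[P]_w (expR (a * b w))%:E = (expR (a ^+ 2 * s ^+ 2 / 2))%:E.
Proof.
move=> s0 mb law; rewrite -normal_mgf//.
have mb' : measurable_fun setT (b : Om -> measurableTypeR R) by exact: mb.
pose f : {mfun Om >-> measurableTypeR R} :=
  HB.pack (b : Om -> measurableTypeR R) (isMeasurableFun.Build _ _ _ _ _ mb').
have -> : \int[normal_prob 0 s]_x (expR (a * x))%:E =
    \int[distribution P f]_x (expR (a * x))%:E.
  by apply: eq_measure_integral => A mA _; exact/esym/law.
rewrite ge0_integral_distribution//.
by apply/measurable_EFinP/measurableT_comp.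
Qed.

Lemma measurable_wrtP (G : set (set Om)) (X : Om -> R) :
  measurable_fun setT (X : g_sigma_algebraType G -> R) <-> measurable_wrt <<s G >> X.
Proof.
split=> [mX B mB|mX _ B mB]; last by rewrite setTI; exact: mX.
by have := mX measurableT B mB; rewrite setTI.
Qed.

(** Each further variable is independent of the preceding ones and contributes
    its own Gaussian factor. *)
Lemma gaussian_sum_mgf (s : R) (G : nat -> set (set Om)) (b : nat -> Om -> R)
    (a : nat -> R) n : s != 0%R ->
  (forall k, sigma_algebra setT (G k)) -> (forall k, G k `<=` measurable) ->
  mutually_indep P G ->
  (forall k, measurable_wrt (G k) (b k)) ->
  (forall k B, measurable B -> P (b k @^-1` B) = normal_prob 0 s B) ->
  \int[P]_w (expR (\sum_(k < n) a k * b k w))%:E =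
    (expR (s ^+ 2 / 2 * \sum_(k < n) a k ^+ 2))%:E.
Proof.
move=> s0 sG mG indep mb law; elim: n => [|n IHn].
  under eq_integral do rewrite big_ord0 expR0.
  by rewrite integral_cst//= probability_setT mule1 big_ord0 mulr0 expR0.
pose past : set (set Om) := [set A | exists2 i, (i < n)%N & G i A].
have mpast : <<s past >> `<=` measurable.
  apply: smallest_sub; first exact: sigma_algebra_measurable.
  by move=> A [i _]; exact: mG.
have Gn : <<s G n >> = G n by exact: smallest_id.
have mS : measurable_fun setT ((fun w => \sum_(k < n) a k * b k w)%R :
    g_sigma_algebraType past -> R).
  apply: measurable_sum => k; apply: measurable_funM => //.
  apply/measurable_wrtP => B mB; apply: sub_sigma_algebra.
  by exists k => //; exact: mb.
have mbn : measurable_fun setT (b n : g_sigma_algebraType (G n) -> R).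
  by apply/measurable_wrtP; rewrite Gn.
have mb' : measurable_fun setT (b n).
  by move=> _ B mB; rewrite setTI; apply: mG; exact: mb.
pose Phi (z : g_sigma_algebraType past * g_sigma_algebraType (G n)) :=
  ((expR (\sum_(k < n) a k * b k z.1))%:E * (expR (a n * b n z.2))%:E).
under eq_integral do rewrite big_ord_recr/= expRD EFinM.
rewrite (decoupling_sigma (Phi := Phi) _ _ _ _ _).2//; first last.
- by move=> z; rewrite mule_ge0// lee_fin expR_ge0.
- apply: emeasurable_funM; apply/measurable_EFinP/measurableT_comp => //.
    exact: (measurableT_comp mS).
  by apply: measurable_funM => //; exact: (measurableT_comp mbn).
- by rewrite Gn; exact: mutually_indep_past.
- by rewrite Gn; exact: mG.
rewrite /Phi/=.
have mE : measurable_fun setT (fun w => (expR (a n * b n w))%:E).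
  by apply/measurable_EFinP/measurableT_comp => //; exact: measurable_funM.
have inner w : \int[P]_w' ((expR (\sum_(k < n) a k * b k w))%:E *
      (expR (a n * b n w'))%:E) =
    (expR (a n ^+ 2 * s ^+ 2 / 2))%:E * (expR (\sum_(k < n) a k * b k w))%:E.
  rewrite ge0_integralZl//.
  by rewrite (gaussian_mgf _ s0 mb' (law n)) muleC.
under eq_integral do rewrite inner.
rewrite ge0_integralZl//; last first.
  apply/measurable_EFinP/measurableT_comp => //.
  apply: measurable_sum => k; apply: measurable_funM => //.
  by move=> _ B mB; rewrite setTI; apply: mG; exact: mb.
rewrite IHn -EFinM -expRD big_ord_recr/=; congr (expR _)%:E.
by ring.
Qed.

End gaussian.

(** * Moments of the noise *)

(** Jensen's inequality for the power [j.+1] and the weights [w], which need not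
    sum to 1. *)
Lemma power_mean (R : realType) n (w t : nat -> R) j :
  (forall i, (0 <= w i)%R) -> (forall i, (0 <= t i)%R) ->
  ((\sum_(i < n) w i * t i) ^+ j.+1 <=
   (\sum_(i < n) w i) ^+ j * \sum_(i < n) w i * t i ^+ j.+1)%R.
Proof.
move=> w0 t0.
have S0 (F : nat -> R) : (forall i, (0 <= F i)%R) -> (0 <= \sum_(i < n) F i)%R.
  by move=> F0; apply: sumr_ge0.
elim: j => [|j IHj]; first by rewrite expr0 mul1r expr1.
(* Chebyshev's sum inequality for the similarly ordered t and t ^+ j.+1 *)
have cheb : ((\sum_(i < n) w i * t i) * (\sum_(i < n) w i * t i ^+ j.+1) <=
    (\sum_(i < n) w i) * (\sum_(i < n) w i * t i ^+ j.+2))%R.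
  rewrite -subr_ge0 -(pmulr_rge0 _ (ltr0n R 2)).
  rewrite [leRHS](_ : _ = \sum_(i < n) \sum_(l < n)
     w i * w l * ((t i - t l) * (t i ^+ j.+1 - t l ^+ j.+1)))%R.
    apply: sumr_ge0 => i _; apply: sumr_ge0 => l _.
    apply: mulr_ge0; first exact: mulr_ge0.
    have [tl|/ltW tl] := leP (t i) (t l).
      by rewrite mulr_le0// subr_le0// lerXn2r// nnegrE.
    by rewrite mulr_ge0// subr_ge0// lerXn2r// nnegrE.
  rewrite [RHS](_ : _ =
    (\sum_(i < n) \sum_(l < n) w l * (w i * t i ^+ j.+2)) +
    (\sum_(i < n) \sum_(l < n) w i * (w l * t l ^+ j.+2)) -
    (\sum_(i < n) \sum_(l < n) (w i * t i) * (w l * t l ^+ j.+1)) -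
    (\sum_(i < n) \sum_(l < n) (w l * t l) * (w i * t i ^+ j.+1)))%R; last first.
    rewrite -big_split/= -!sumrB; apply: eq_bigr => i _.
    rewrite -big_split/= -!sumrB; apply: eq_bigr => l _.
    by rewrite !exprS; ring.
  set A := (\sum_(i < n) w i)%R; set B := (\sum_(i < n) w i * t i ^+ j.+2)%R.
  set C := (\sum_(i < n) w i * t i)%R; set D := (\sum_(i < n) w i * t i ^+ j.+1)%R.
  have dist (F G : nat -> R) : (\sum_(i < n) \sum_(l < n) F i * G l =
      (\sum_(i < n) F i) * (\sum_(i < n) G i))%R.
    by rewrite mulr_suml; apply: eq_bigr => i _; rewrite mulr_sumr.
  have distC (F G : nat -> R) : (\sum_(i < n) \sum_(l < n) F l * G i =
      (\sum_(i < n) F i) * (\sum_(i < n) G i))%R.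
    by rewrite exchange_big/= dist.
  rewrite (distC w (fun i => w i * t i ^+ j.+2)%R) (dist w (fun i => w i * t i ^+ j.+2)%R).
  rewrite (dist (fun i => w i * t i)%R (fun i => w i * t i ^+ j.+1)%R).
  rewrite (distC (fun i => w i * t i)%R (fun i => w i * t i ^+ j.+1)%R).
  by rewrite -/A -/B -/C -/D; ring.
rewrite exprS; apply: le_trans (ler_wpM2l _ IHj) _.
  by apply: (S0 (fun i => w i * t i)%R) => i; rewrite mulr_ge0.
rewrite mulrCA [leRHS](_ : _ = (\sum_(i < n) w i) ^+ j *
  ((\sum_(i < n) w i) * \sum_(i < n) w i * t i ^+ j.+2))%R; last first.
  by rewrite exprSr mulrA.
by rewrite ler_wpM2l// exprn_ge0// S0.
Qed.

Section expectation_bounds.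
Context {R : realType} {dW : measure_display} {Om : measurableType dW}.
Context (P : probability Om R).
Local Open Scope ereal_scope.

Lemma fatou_le (f : nat -> Om -> R) (g : Om -> R) (C : \bar R) :
  (forall n, measurable_fun setT (f n)) -> measurable_fun setT g ->
  (forall n w, (0 <= f n w)%R) ->
  {ae P, forall w, f n w @[n --> \oo] --> g w} ->
  (forall n, \int[P]_w (f n w)%:E <= C) -> \int[P]_w (g w)%:E <= C.
Proof.
move=> mf mg f0 fg fC.
have mfE n : measurable_fun setT (fun w => (f n w)%:E) by exact/measurable_EFinP.
have mlim : measurable_fun setT (fun w => limn_einf (fun n => (f n w)%:E)).
  rewrite (_ : (fun w => _) = (fun w => - limn_esup (fun n => - (f n w)%:E))).
    apply: measurableT_comp => //; apply: measurable_fun_limn_esup => n.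
    exact: measurableT_comp.
  by apply/funext => w; rewrite limn_esupN oppeK.
rewrite (ae_eq_integral (fun w => limn_einf (fun n => (f n w)%:E)))//; first last.
- apply: filterS fg => w fgw _; apply/esym.
  have fgE : (f n w)%:E @[n --> \oo] --> (g w)%:E.
    by apply: cvg_EFin fgw; exact: nearW.
  by have [-> _] := cvg_limn_einf_sup fgE.
- exact/measurable_EFinP.
have := @fatou _ _ _ P setT measurableT (fun n w => (f n w)%:E) mfE.
move=> /(_ (fun n w _ => f0 n w)) /le_trans; apply.
rewrite limn_einf_lim; apply: lime_le; first exact: is_cvg_einfs.
apply: nearW => n; apply: le_trans (fC n).
by apply: ereal_inf_lbound; exists n => /=.
Qed.

End expectation_bounds.

Section noise_moments.
Context {R : realType} {dW : measure_display} {Om : measurableType dW}.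
Context (P : probability Om R) (tau : R) (b : nat -> Om -> R).

(** The generating function characterizes independent centred Gaussian variables
    of variance [tau]. *)
Record white_noise : Prop := {
  noise_measurable : forall k, measurable_fun setT (b k) ;
  noise_mgf : forall n (a : nat -> R),
    (\int[P]_w (expR (\sum_(k < n) a k * b k w))%:E =
      (expR (tau / 2 * \sum_(k < n) a k ^+ 2))%:E)%E
}.

Context (noise : white_noise) (tau_gt0 : 0 < tau).

(** The bound that [even_pow_le_expR] gives for a centred Gaussian variable of
    variance 1. *)
Definition moment_cst j : R := (2 * j)`!%:R * (2 * expR 2^-1).

Lemma moment_cst_gt0 j : 0 < moment_cst j.
Proof. by rewrite /moment_cst !mulr_gt0// ?expR_gt0// ltr0n fact_gt0. Qed.

(** A single term of the exponential series is at most the whole series. *)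
Lemma even_pow_le_expR (z : R) j :
  z ^+ (2 * j) <= (2 * j)`!%:R * (expR z + expR (- z)).
Proof.
have f0 : (0 : R) < (2 * j)`!%:R by rewrite ltr0n fact_gt0.
have key : `|z| ^+ (2 * j) <= (2 * j)`!%:R * expR `|z|.
  rewrite mulrC -ler_pdivrMr//.
  case: (2 * j)%N => [|n].
    by rewrite expr0 fact0 divr1; apply: le_trans (expR_ge1Dx _); rewrite lerDl.
  by apply: le_trans (expR_ge1Dxn n (normr_ge0 z)); rewrite lerDr.
rewrite [leLHS](_ : _ = `|z| ^+ (2 * j)); last first.
  by rewrite !exprM real_normK ?num_real.
apply: le_trans key _; rewrite ler_pM2l//.
have := expR_ge0 z; have := expR_ge0 (- z).
case: (ger0P z) => _; lra.
Qed.

Lemma measurable_noise_sum n (a : nat -> R) :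
  measurable_fun setT (fun w => \sum_(k < n) a k * b k w).
Proof.
by apply: measurable_sum => k; apply: measurable_funM => //;
  exact: noise_measurable noise k.
Qed.

(** The sum is Gaussian of variance [tau * S]. Its power is compared with
    exponentials of the sum divided by its standard deviation, whose mean does
    not depend on the variance. *)
Lemma noise_even_moment n (a : nat -> R) j :
  (\int[P]_w ((\sum_(k < n) a k * b k w) ^+ (2 * j.+1))%:E <=
    (moment_cst j.+1 * (tau * \sum_(k < n) a k ^+ 2) ^+ j.+1)%:E)%E.
Proof.
set S := \sum_(k < n) a k ^+ 2.
have mb := measurable_noise_sum n.
have S0 : 0 <= S by apply: sumr_ge0 => k _; exact: sqr_ge0.
(* without variance there is no scale to normalize by *)
have [Sz|Sn] := eqVneq S 0.
  have az (k : 'I_n) : a k = 0.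
    apply/eqP; rewrite -sqrf_eq0 eq_le sqr_ge0 andbT -Sz /S (bigD1 k)//= lerDl.
    by apply: sumr_ge0 => l _; exact: sqr_ge0.
  rewrite (eq_integral (cst 0%E)) ?integral0.
    by rewrite lee_fin Sz mulr0 expr0n mulr0.
  by move=> w _; rewrite big1 ?mulnS ?expr0n// => k _; rewrite az mul0r.
have Sp : 0 < tau * S by rewrite mulr_gt0// lt_neqAle eq_sym Sn.
(* the inverse of the standard deviation of the sum *)
pose th := (Num.sqrt (tau * S))^-1.
have th0 : 0 < th by rewrite invr_gt0 sqrtr_gt0.
have thS : th ^+ 2 * (tau * S) = 1.
  by rewrite /th exprVn sqr_sqrtr ?ltW// mulVf// gt_eqF.
pose B w := (((tau * S) ^+ j.+1 * (2 * j.+1)`!%:R)%:E *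
   ((expR (\sum_(k < n) (th * a k) * b k w))%:E +
    (expR (\sum_(k < n) (- th * a k) * b k w))%:E))%E.
have bound w : (((\sum_(k < n) a k * b k w) ^+ (2 * j.+1))%:E <= B w)%E.
  rewrite /B.
  set z := \sum_(k < n) a k * b k w.
  have zE c : \sum_(k < n) (c * a k) * b k w = c * z.
    by rewrite /z mulr_sumr; apply: eq_bigr => k _; rewrite mulrA.
  rewrite -EFinD -EFinM lee_fin !zE mulNr -mulrA.
  rewrite [leLHS](_ : _ = (tau * S) ^+ j.+1 * (th * z) ^+ (2 * j.+1)); last first.
    by rewrite !exprM -exprMn (exprMn _ th) mulrA (mulrC (tau * S)) thS mul1r.
  by rewrite ler_pM2l ?exprn_gt0// even_pow_le_expR.
have me c : measurable_fun setT (fun w => (expR (\sum_(k < n) (c * a k) * b k w))%:E).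
  apply/measurable_EFinP/measurableT_comp => //.
  exact: (measurable_noise_sum n (fun k => c * a k)).
apply: (@le_trans _ _ (\int[P]_w B w)%E).
  apply: ge0_le_integral => //.
  - by move=> w _; rewrite lee_fin exprM exprn_ge0// sqr_ge0.
  - by apply/measurable_EFinP/measurable_funX.
  - by apply: emeasurable_funM => //; apply: emeasurable_funD; exact: me.
rewrite /B ge0_integralZl//; last 3 first.
- by apply: emeasurable_funD; exact: me.
- by move=> w _; rewrite adde_ge0// lee_fin expR_ge0.
- by rewrite lee_fin mulr_ge0// exprn_ge0// ltW.
rewrite ge0_integralD//.
have mgf c : c ^+ 2 = th ^+ 2 ->
    (\int[P]_w (expR (\sum_(k < n) (c * a k) * b k w))%:E = (expR 2^-1)%:E)%E.
  move=> cth; rewrite (noise_mgf noise n (fun k => c * a k)); congr (expR _)%:E.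
  under eq_bigr do rewrite exprMn.
  rewrite -mulr_sumr -/S cth.
  have -> : tau / 2 * (th ^+ 2 * S) = th ^+ 2 * (tau * S) / 2 by ring.
  by rewrite thS mul1r.
rewrite !mgf ?sqrrN// -EFinD -EFinM lee_fin /moment_cst.
by rewrite le_eqVlt; apply/orP; left; apply/eqP; ring.
Qed.

Context {H : spectral R}.
Implicit Types (a : nat -> H) (v : H).

(** The truncation of the noise to the first [n] Brownian motions, [a k] being
    the image of the k-th direction under the diffusion operator. *)
Definition noise_vector a n w : H := \sum_(k < n) b k w *: a k.

Lemma dot_noise_vector a n w x :
  dot x (noise_vector a n w) = \sum_(k < n) dot x (a k) * b k w.
Proof.
by rewrite dot_sumr; apply: eq_bigr => k _; rewrite dotZr mulrC.
Qed.

Lemma measurable_dot_noise a n x :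
  measurable_fun setT (fun w => dot x (noise_vector a n w)).
Proof.
under eq_fun do rewrite dot_noise_vector.
exact: (measurable_noise_sum n (fun k => dot x (a k))).
Qed.

Lemma measurable_sqr_noise a n :
  measurable_fun setT (fun w => dot (noise_vector a n w) (noise_vector a n w)).
Proof.
under eq_fun => w do rewrite {1}/noise_vector dot_suml.
apply: measurable_sum => k.
under eq_fun => w do rewrite dotZl.
apply: measurable_funM; first exact: noise_measurable noise k.
exact: measurable_dot_noise.
Qed.

(** The squared norm is the weighted mean of the squared coordinates divided by
    their variances; [power_mean] reduces its moments to those of the
    coordinates, and Bessel's inequality bounds the sum of the weights. *)
Lemma noise_norm_moment a n j :
  (\int[P]_w (dot (noise_vector a n w) (noise_vector a n w) ^+ j.+1)%:E <=
    (moment_cst j.+1 * (tau * \sum_(k < n) dot (a k) (a k)) ^+ j.+1)%:E)%E.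
Proof.
pose y := noise_vector a n; set A := \sum_(k < n) dot (a k) (a k).
pose W l := \sum_(k < n) coord (a k) l ^+ 2.
have W0 l : 0 <= W l by apply: sumr_ge0 => k _; exact: sqr_ge0.
have yE l w : coord (y w) l = \sum_(k < n) coord (a k) l * b k w.
  by rewrite /coord dotC dot_noise_vector; under eq_bigr do rewrite dotC.
have WA L : \sum_(l < L) W l <= A.
  by rewrite exchange_big/=; apply: ler_sum => k _; exact: bessel.
have my l : measurable_fun setT (fun w => coord (y w) l).
  under eq_fun do rewrite yE.
  exact: (measurable_noise_sum n (fun k => coord (a k) l)).
pose S L w := \sum_(l < L) coord (y w) l ^+ 2.
have S0 L w : 0 <= S L w by apply: sumr_ge0 => l _; exact: sqr_ge0.
have mS L : measurable_fun setT (S L).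
  by apply: measurable_sum => l; exact: measurable_funX.
apply: (@fatou_le _ _ _ P (fun L w => S L w ^+ j.+1)).
- by move=> L; exact: measurable_funX.
- by apply: measurable_funX; exact: measurable_sqr_noise.
- by move=> L w; rewrite exprn_ge0.
- apply: nearW => w; have hS : S L w @[L --> \oo] --> dot (y w) (y w).
    have := @parseval _ _ (y w) (y w).
    by under eq_fun do under eq_bigr do rewrite -expr2.
  exact: cvg_expn.
(* the coordinate of index l has variance tau * W l, and vanishes if W l does *)
move=> L; pose t w l := if W l == 0 then 0 else coord (y w) l ^+ 2 / W l.
have wt w l : coord (y w) l ^+ 2 = W l * t w l.
  rewrite /t; case: eqP => [Wl|/eqP Wl]; last by rewrite mulrC divfK.
  rewrite Wl mulr0 yE big1 ?expr0n// => k _.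
  suff -> : coord (a k) l = 0 by rewrite mul0r.
  apply/eqP; rewrite -sqrf_eq0 eq_le sqr_ge0 andbT -Wl /W (bigD1 k)//= lerDl.
  by apply: sumr_ge0 => i _; exact: sqr_ge0.
have t0 w l : 0 <= t w l.
  by rewrite /t; case: ifP => // _; rewrite divr_ge0// sqr_ge0.
have mt l : measurable_fun setT (t ^~ l).
  rewrite /t; case: (W l == 0); first exact: measurable_cst.
  by apply: measurable_funM => //; exact: measurable_funX.
pose B w := ((\sum_(l < L) W l) ^+ j * \sum_(l < L) W l * t w l ^+ j.+1).
have term0 l w : 0 <= W l * t w l ^+ j.+1 by rewrite mulr_ge0// exprn_ge0.
have mterm l : measurable_fun setT (fun w => W l * t w l ^+ j.+1).
  by apply: measurable_funM => //; exact: measurable_funX.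
apply: (@le_trans _ _ (\int[P]_w (B w)%:E)%E).
  apply: ge0_le_integral => //.
  - by move=> w _; rewrite lee_fin exprn_ge0.
  - by apply/measurable_EFinP; exact: measurable_funX.
  - apply/measurable_EFinP; apply: measurable_funM => //.
    exact: measurable_sum.
  - move=> w _; rewrite lee_fin /S; under eq_bigr do rewrite wt.
    exact: power_mean.
have moment l : (\int[P]_w (W l * t w l ^+ j.+1)%:E <=
    (moment_cst j.+1 * tau ^+ j.+1 * W l)%:E)%E.
  have [Wl|Wl] := eqVneq (W l) 0.
    under eq_integral do rewrite Wl mul0r.
    by rewrite Wl integral0 mulr0.
  have Wp : 0 < W l by rewrite lt_neqAle eq_sym Wl W0.
  have E w : W l * t w l ^+ j.+1 =
      (W l ^+ j)^-1 * (\sum_(k < n) coord (a k) l * b k w) ^+ (2 * j.+1).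
    rewrite /t (negbTE Wl) -yE expr_div_n -exprM exprS invfM mulrCA mulrA.
    by rewrite mulrA mulfK// mulrC.
  under eq_integral do rewrite E EFinM.
  rewrite ge0_integralZl//; last 3 first.
  - apply/measurable_EFinP; apply: measurable_funX.
    exact: (measurable_noise_sum n (fun k => coord (a k) l)).
  - by move=> w _; rewrite lee_fin exprM exprn_ge0// sqr_ge0.
  - by rewrite lee_fin invr_ge0 exprn_ge0.
  apply: le_trans (lee_wpmul2l _ (noise_even_moment n (fun k => coord (a k) l) j)) _.
    by rewrite lee_fin invr_ge0 exprn_ge0.
  rewrite -EFinM lee_fin -/(W l) exprMn [W l ^+ j.+1]exprS.
  rewrite [leLHS](_ : _ = moment_cst j.+1 * tau ^+ j.+1 * (W l * (W l ^+ j / W l ^+ j))).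
    by rewrite divff ?expf_neq0// mulr1.
  by ring.
rewrite /B; under eq_integral do rewrite EFinM.
rewrite ge0_integralZl//; last 3 first.
- by apply/measurable_EFinP; exact: measurable_sum.
- by move=> w _; rewrite lee_fin sumr_ge0.
- by rewrite lee_fin exprn_ge0// sumr_ge0.
under eq_integral do rewrite -sumEFin.
rewrite ge0_integral_sum//; last 2 first.
- by move=> l; exact/measurable_EFinP.
- by move=> l w _; rewrite lee_fin.
apply: (@le_trans _ _ (((\sum_(l < L) W l) ^+ j)%:E *
    (\sum_(l < L) (moment_cst j.+1 * tau ^+ j.+1 * W l)%:E))%E).
  apply: lee_wpmul2l; first by rewrite lee_fin exprn_ge0// sumr_ge0.
  by apply: lee_sum => l _; exact: moment.
rewrite sumEFin -EFinM lee_fin -mulr_sumr.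
set w := \sum_(l < L) W l.
have w0 : 0 <= w by exact: sumr_ge0.
rewrite exprMn [leLHS](_ : _ = moment_cst j.+1 * (tau ^+ j.+1 * w ^+ j.+1)); last first.
  by rewrite [w ^+ j.+1]exprS; ring.
rewrite ler_pM2l ?moment_cst_gt0// ler_pM2l ?exprn_gt0//.
by rewrite lerXn2r ?nnegrE// ?(le_trans w0)//; exact: WA.
Qed.

End noise_moments.

(** * Moments of the energy after one step *)

Lemma taylor_bound (R : realType) (x : R) m : 0 <= 1 + x -> x <= 2 ->
  (1 + x) ^+ m <= 1 + m%:R * x + 4 ^+ m * x ^+ 2.
Proof.
move=> x0 x2; elim: m => [|m IHm].
  by rewrite !expr0 mul0r addr0 mul1r lerDl sqr_ge0.
rewrite exprSr; apply: le_trans (ler_wpM2r x0 IHm) _.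
have m4 : m%:R <= 4 ^+ m :> R.
  elim: (m) => [|n IHn]; first by rewrite expr0 ler01.
  have n1 : 1 <= 4 ^+ n :> R by rewrite exprn_ege1// ler1n.
  by rewrite exprS -natr1; lra.
have s0 : 0 <= x ^+ 2 by exact: sqr_ge0.
have q0 : 0 <= (4 ^+ m : R) by rewrite exprn_ge0.
rewrite [4 ^+ m.+1]exprS -[m.+1%:R]natr1.
move: (4 ^+ m) q0 m4 => Q q0 m4; move: (m%:R : R) m4 => M m4.
have : Q * x ^+ 2 * (1 + x) <= Q * x ^+ 2 * 3.
  by apply: ler_wpM2l; [exact: mulr_ge0|lra].
have : M * x ^+ 2 <= Q * x ^+ 2 by exact: ler_wpM2r.
lra.
Qed.

(** [1 + c + r / 2] is the relative energy after one step. The part [c], of mean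
    zero, is kept inside an exponential, whose mean is known exactly; what is
    left is of the order of [r], hence small in mean with the step size. *)
Lemma power_increment (R : realType) (c r : R) m :
  0 <= r -> c ^+ 2 <= 2 * r -> 0 <= 1 + c + r / 2 ->
  (1 + c + r / 2) ^+ m.+1 <=
    expR (m.+1%:R * c) + (m.+1%:R + 5 * 4 ^+ m.+1) * (r + r ^+ m.+1).
Proof.
move=> r0 cr h; set M := m.+1%:R : R; set Q := 4 ^+ m.+1 : R.
have M0 : 0 <= M by exact: ler0n.
have Q0 : 0 <= Q by rewrite exprn_ge0.
have rm0 : 0 <= r ^+ m.+1 by exact: exprn_ge0.
(* a small increment is expanded to second order; otherwise c and r / 2 are at
   most of the order of r, and the power of r alone dominates *)
have [r1|r1] := leP r 1.
  have c2 : c <= 3 / 2 by nra.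
  have x2 : c + r / 2 <= 2 by lra.
  have := @taylor_bound _ (c + r / 2) m.+1; rewrite addrA => /(_ h x2) /le_trans; apply.
  rewrite -/M -/Q; have := expR_ge1Dx (M * c).
  have sq : (c + r / 2) ^+ 2 <= 5 * r.
    have : 0 <= (c - r / 2) ^+ 2 by exact: sqr_ge0.
    have : r * r <= r by rewrite ler_piMl.
    rewrite (_ : (c + r / 2) ^+ 2 = 2 * c ^+ 2 + r * r / 2 - (c - r / 2) ^+ 2).
      lra.
    by field.
  have : Q * (c + r / 2) ^+ 2 <= Q * (5 * r) by rewrite ler_wpM2l.
  have : 0 <= M * r by rewrite mulr_ge0.
  have : 0 <= M * r ^+ m.+1 by rewrite mulr_ge0.
  have : 0 <= Q * r ^+ m.+1 by rewrite mulr_ge0.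
  lra.
have cr2 : c <= 2 * r by nra.
have : (1 + c + r / 2) ^+ m.+1 <= (4 * r) ^+ m.+1.
  by rewrite lerXn2r ?nnegrE//; lra.
rewrite exprMn -/Q; have := expR_ge0 (M * c).
have : 0 <= M * r by rewrite mulr_ge0.
have : 0 <= M * r ^+ m.+1 by rewrite mulr_ge0.
have : 0 <= Q * r ^+ m.+1 by rewrite mulr_ge0.
have : 0 <= Q * r by rewrite mulr_ge0.
lra.
Qed.

Lemma expR_le1D (R : realType) (x : R) : expR x <= 1 + x * expR x.
Proof.
have := expR_ge1Dx (- x); rewrite expRN => h.
have e0 := expR_gt0 x.
have := ler_wpM2r (ltW e0) h; rewrite mulVf ?gt_eqF//; lra.
Qed.

Section energy_increment.
Context {R : realType} {dW : measure_display} {Om : measurableType dW}.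
Context (P : probability Om R) (tau T : R) (b : nat -> Om -> R).
Context (noise : white_noise P tau b) (tau_gt0 : 0 < tau) (tauT : tau <= T).
Context {H : spectral R}.

(** The first summand comes from the generating function of the part of mean
    zero, the second from the moments of the squared norm of the noise. *)
Definition growth_cst (C0 : R) m : R :=
  m.+1%:R ^+ 2 * C0 * expR (m.+1%:R ^+ 2 * C0 * T) +
  (m.+1%:R + 5 * 4 ^+ m.+1) *
    (moment_cst 1 * C0 + moment_cst m.+1 * C0 ^+ m.+1 * T ^+ m).

Lemma growth_cst_ge0 (C0 : R) m : 0 <= C0 -> 0 <= T -> 0 <= growth_cst C0 m.
Proof.
move=> c0 t0; have m0 j : 0 <= moment_cst j :> R by exact/ltW/moment_cst_gt0.
by rewrite /growth_cst addr_ge0 ?mulr_ge0 ?addr_ge0 ?mulr_ge0 ?expR_ge0 ?exprn_ge0.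
Qed.

(** The state ([v], [a], [s]) is frozen, so the noise is Gaussian. Dividing by
    [s], which dominates the kinetic energy and the size of the coefficients,
    gives relative increments to which [power_increment] applies; both their
    first order effects have a mean of the order of [tau]. *)
Lemma frozen_increment (v : H) (a : nat -> H) n (s C0 : R) m :
  0 < s -> dot v v <= 2 * s -> \sum_(k < n) dot (a k) (a k) <= C0 * s ->
  (\int[P]_w ((s + dot v (noise_vector b a n w) +
      dot (noise_vector b a n w) (noise_vector b a n w) / 2) ^+ m.+1)%:E <=
   ((1 + growth_cst C0 m * tau) * s ^+ m.+1)%:E)%E.
Proof.
move=> s0 vs As; pose y := noise_vector b a n; rewrite -/y.
set M := m.+1%:R : R; set K := (M + 5 * 4 ^+ m.+1).
set A := \sum_(k < n) dot (a k) (a k) in As.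
have A0 : 0 <= A by apply: sumr_ge0 => k _; exact: dot_ge0.
have T0 : 0 < T by exact: lt_le_trans tauT.
have C00 : 0 <= C0 by rewrite -(pmulr_lge0 _ s0) (le_trans A0).
have K0 : 0 <= K by rewrite addr_ge0// mulr_ge0// exprn_ge0.
pose c w := dot v (y w) / s; pose r w := dot (y w) (y w) / s.
have r0 w : 0 <= r w by rewrite divr_ge0 ?dot_ge0 ?ltW.
have cr w : c w ^+ 2 <= 2 * r w.
  rewrite /c /r expr_div_n ler_pdivrMr ?exprn_gt0//.
  apply: le_trans (dot_sqr_le _ _) _.
  rewrite [leRHS](_ : _ = (2 * s) * dot (y w) (y w)); last first.
    by field; rewrite gt_eqF.
  by rewrite ler_wpM2r// dot_ge0.
have cr0 w : 0 <= 1 + c w + r w / 2.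
  rewrite -(pmulr_rge0 _ s0).
  rewrite (_ : s * _ = s + dot v (y w) + dot (y w) (y w) / 2); last first.
    by rewrite /c /r; field; rewrite gt_eqF.
  have := dot_ge0 (v + y w); rewrite dot_sqrD; lra.
have mc : measurable_fun setT c.
  by apply: measurable_funM => //; exact: (measurable_dot_noise noise).
have mr : measurable_fun setT r.
  by apply: measurable_funM => //; exact: (measurable_sqr_noise noise).
have mu : measurable_fun setT (fun w => (1 + c w + r w / 2) ^+ m.+1).
  apply: measurable_funX; apply: measurable_funD; last exact: measurable_funM.
  exact: measurable_funD.
have E w : (s + dot v (y w) + dot (y w) (y w) / 2) ^+ m.+1 =
    s ^+ m.+1 * (1 + c w + r w / 2) ^+ m.+1.
  rewrite -exprMn; congr (_ ^+ _); rewrite /c /r; field; by rewrite gt_eqF.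
have mexp : measurable_fun setT (fun w => (expR (M * c w))%:E).
  by apply/measurable_EFinP/measurableT_comp => //; exact: measurable_funM.
have mrr : measurable_fun setT (fun w => (r w + r w ^+ m.+1)%:E).
  by apply/measurable_EFinP/measurable_funD => //; exact: measurable_funX.
under eq_integral do rewrite E EFinM.
rewrite ge0_integralZl//; last 3 first.
- exact/measurable_EFinP.
- by move=> w _; rewrite lee_fin exprn_ge0.
- by rewrite lee_fin exprn_ge0// ltW.
rewrite mulrC EFinM; apply: lee_wpmul2l; first by rewrite lee_fin exprn_ge0// ltW.
apply: (@le_trans _ _ (\int[P]_w ((expR (M * c w))%:E + K%:E * (r w + r w ^+ m.+1)%:E))%E).
  apply: ge0_le_integral => //.
  - by move=> w _; rewrite lee_fin exprn_ge0.
  - exact/measurable_EFinP.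
  - by apply: emeasurable_funD => //; exact: emeasurable_funM.
  - by move=> w _; rewrite -EFinM -EFinD lee_fin; exact: power_increment.
have rr0 w : 0 <= r w + r w ^+ m.+1 by rewrite addr_ge0// exprn_ge0.
rewrite ge0_integralD//; last 2 first.
- by move=> w _; rewrite mule_ge0 ?lee_fin.
- by exact: emeasurable_funM.
rewrite ge0_integralZl//; last first.
- by move=> w _; rewrite lee_fin.
have Iexp : (\int[P]_w (expR (M * c w))%:E <=
    (1 + M ^+ 2 * C0 * expR (M ^+ 2 * C0 * T) * tau)%:E)%E.
  have -> : (\int[P]_w (expR (M * c w))%:E =
      (expR (tau / 2 * \sum_(k < n) (M / s * dot v (a k)) ^+ 2))%:E)%E.
    rewrite -(noise_mgf noise n (fun k => M / s * dot v (a k))).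
    apply: eq_integral => w _; congr (expR _)%:E.
    rewrite /c dot_noise_vector mulrA mulrAC mulr_sumr.
    by apply: eq_bigr => k _; rewrite mulrA.
  rewrite lee_fin; set x := tau / 2 * _.
  have xle : x <= M ^+ 2 * C0 * tau.
    rewrite /x; under eq_bigr do rewrite exprMn.
    rewrite -mulr_sumr.
    have vA : \sum_(k < n) dot v (a k) ^+ 2 <= 2 * s * (C0 * s).
      apply: (@le_trans _ _ (dot v v * A)).
        by rewrite mulr_sumr; apply: ler_sum => k _; exact: dot_sqr_le.
      by apply: ler_pM => //; exact: dot_ge0.
    rewrite [leRHS](_ : _ = tau / 2 * ((M / s) ^+ 2 * (2 * s * (C0 * s)))); last first.
      by field; rewrite gt_eqF.
    apply: ler_wpM2l; first by rewrite divr_ge0// ltW.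
    by apply: ler_wpM2l => //; exact: sqr_ge0.
  apply: (@le_trans _ _ (expR (M ^+ 2 * C0 * tau))); first by rewrite ler_expR.
  apply: le_trans (expR_le1D _) _; rewrite lerD2l.
  have MC : 0 <= M ^+ 2 * C0 by rewrite mulr_ge0// sqr_ge0.
  rewrite -!mulrA (mulrC tau) !mulrA ler_pM2r//.
  by apply: ler_wpM2l => //; rewrite ler_expR; exact: ler_wpM2l.
have Ipow j : (\int[P]_w (r w ^+ j.+1)%:E <=
    (moment_cst j.+1 * (tau * C0) ^+ j.+1)%:E)%E.
  under eq_integral do rewrite /r expr_div_n mulrC EFinM.
  rewrite ge0_integralZl//; last 3 first.
  - by apply/measurable_EFinP/measurable_funX; exact: (measurable_sqr_noise noise).
  - by move=> w _; rewrite lee_fin exprn_ge0// dot_ge0.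
  - by rewrite lee_fin invr_ge0 exprn_ge0// ltW.
  apply: le_trans (lee_wpmul2l _ (noise_norm_moment noise tau_gt0 a n j)) _.
    by rewrite lee_fin invr_ge0 exprn_ge0// ltW.
  have AX : (tau * A) ^+ j.+1 <= (tau * C0) ^+ j.+1 * s ^+ j.+1.
    rewrite -exprMn lerXn2r ?nnegrE ?mulr_ge0//; [exact: ltW..|].
    by rewrite -mulrA ler_pM2l.
  rewrite -EFinM lee_fin -/A mulrCA ler_pM2l ?moment_cst_gt0//.
  by rewrite mulrC ler_pdivrMr ?exprn_gt0.
have Irr : (\int[P]_w (r w + r w ^+ m.+1)%:E <=
    ((moment_cst 1 * C0 + moment_cst m.+1 * C0 ^+ m.+1 * T ^+ m) * tau)%:E)%E.
  under eq_integral do rewrite EFinD.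
  rewrite ge0_integralD//; last 4 first.
  - by move=> w _; rewrite lee_fin.
  - exact/measurable_EFinP.
  - by move=> w _; rewrite lee_fin exprn_ge0.
  - by apply/measurable_EFinP/measurable_funX.
  rewrite mulrDl EFinD; apply: leeD.
    apply: le_trans (Ipow 0%N) _.
    by rewrite lee_fin -[(tau * C0) ^+ 1]/(tau * C0) (mulrC tau) mulrA.
  apply: le_trans (Ipow m) _; rewrite lee_fin exprMn [tau ^+ m.+1]exprSr.
  have D0 : 0 <= moment_cst m.+1 * C0 ^+ m.+1 * tau.
    by rewrite !mulr_ge0 ?exprn_ge0// ltW// moment_cst_gt0.
  have tT : tau ^+ m <= T ^+ m by rewrite lerXn2r ?nnegrE//; exact: ltW.
  rewrite (_ : _ * (_ * _) = moment_cst m.+1 * C0 ^+ m.+1 * tau * tau ^+ m); last by ring.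
  rewrite [leRHS](_ : _ = moment_cst m.+1 * C0 ^+ m.+1 * tau * T ^+ m); last by ring.
  exact: ler_wpM2l.
apply: le_trans (leeD Iexp (lee_wpmul2l _ Irr)) _; first by rewrite lee_fin.
rewrite -EFinM -EFinD lee_fin /growth_cst -/M -/K.
by rewrite le_eqVlt; apply/orP; left; apply/eqP; ring.
Qed.

End energy_increment.

(** * The wave group and the energy balance of one step *)

Lemma is_derive_of_quotient (R : realType) (f : R -> R) (t l : R) :
  h^-1 * (f (h + t) - f t) @[h --> 0^'] --> l -> is_derive t 1 f l.
Proof.
move=> h.
have E : (fun h : R => h^-1 *: ((f \o shift t) (h *: (1:R)) - f t)) =
    (fun h => h^-1 * (f (h + t) - f t)).
  by apply/funext => r; rewrite /= [r *: 1]mulr1.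
by apply: DeriveDef; rewrite /derivable /derive E; [apply/cvg_ex; exists l|exact: cvg_lim h].
Qed.

(** Rotating the pair [(a, b / om)] back by the angle [om t] gives functions with
    zero derivative. *)
Lemma harmonic_solution (R : realType) (a b : R -> R) (om : R) : om != 0 ->
  (forall t : R, is_derive t 1 a (b t)) ->
  (forall t : R, is_derive t 1 b (- (om ^+ 2 * a t))) ->
  forall t,
    a t = cos (om * t) * a 0 + sin (om * t) / om * b 0 /\
    b t = - om * sin (om * t) * a 0 + cos (om * t) * b 0.
Proof.
move=> om0 da db t.
pose c s := cos (om * s); pose s s := sin (om * s).
have dm (r : R) : is_derive r 1 (fun x => om * x) om.
  by have := is_deriveZ om (is_derive_id r 1); rewrite [om *: 1]mulr1.
have dc (r : R) : is_derive r 1 c (- s r * om).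
  exact: (is_derive1_comp (is_derive_cos _) (dm r)).
have ds (r : R) : is_derive r 1 s (c r * om).
  exact: (is_derive1_comp (is_derive_sin _) (dm r)).
have P : c t * a t - om^-1 * (s t * b t) = c 0 * a 0 - om^-1 * (s 0 * b 0).
  apply: (@is_derive_0_is_cst _ (c * a - om^-1 \*: (s * b))) => r.
  apply: is_derive_eq; rewrite /GRing.scale/=.
  by field.
have Q : om * (s t * a t) + c t * b t = om * (s 0 * a 0) + c 0 * b 0.
  apply: (@is_derive_0_is_cst _ (om \*: (s * a) + c * b)) => r.
  apply: is_derive_eq; rewrite /GRing.scale/=.
  by field.
have c0 : c 0 = 1 by rewrite /c mulr0 cos0.
have s0 : s 0 = 0 by rewrite /s mulr0 sin0.
rewrite c0 s0 !mul0r !mulr0 subr0 mul1r in P.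
rewrite c0 s0 !mul0r !mulr0 add0r mul1r in Q.
have cs : c t ^+ 2 + s t ^+ 2 = 1 by exact: cos2Dsin2.
rewrite -/(c t) -/(s t) -P -Q; split.
  transitivity ((c t ^+ 2 + s t ^+ 2) * a t); first by rewrite cs mul1r.
  by field.
transitivity ((c t ^+ 2 + s t ^+ 2) * b t); first by rewrite cs mul1r.
by field.
Qed.

Section wave_equation.
Context {R : realType} {H : spectral R}.
Implicit Types (x y z u v w : H) (X Y Z : H * H) (i : nat) (t a : R).

Definition same_coord X Y := coord X.1 =1 coord Y.1 /\ coord X.2 =1 coord Y.2.

Definition energy_norm X :=
  Num.sqrt (norm (pow (1 / 2) X.1) ^+ 2 + norm X.2 ^+ 2).

Definition finite_energy X := pow_dom (1 / 2) X.1.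

Definition freq i := eigval H i `^ (1 / 2).

Lemma freq_gt0 i : 0 < freq i. Proof. by rewrite powR_gt0// eigval_gt0. Qed.

Lemma freq_neq0 i : freq i != 0. Proof. by rewrite gt_eqF// freq_gt0. Qed.

Lemma sqr_freq i : freq i ^+ 2 = eigval H i.
Proof. by rewrite expr2 pow_half. Qed.

Lemma coord_le_norm x i : `|coord x i| <= norm x.
Proof.
by have := dot_le_norm x (eig H i); rewrite /(norm (eig _ _)) eig_orthonormal eqxx
  sqrtr1 mulr1.
Qed.

Lemma energy_norm_ge0 X : 0 <= energy_norm X. Proof. exact: sqrtr_ge0. Qed.

Lemma energy_norm_le X :
  energy_norm X <= norm (pow (1 / 2) X.1) + norm X.2.
Proof.
have p0 := norm_ge0 (pow (1 / 2) X.1); have q0 := norm_ge0 X.2.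
rewrite -[leRHS]ger0_norm ?addr_ge0// -sqrtr_sqr ler_wsqrtr//; nra.
Qed.

Lemma norm1_le_energy X : norm (pow (1 / 2) X.1) <= energy_norm X.
Proof.
rewrite -[leLHS]ger0_norm ?norm_ge0// -sqrtr_sqr ler_wsqrtr//.
by rewrite lerDl sqr_ge0.
Qed.

Lemma norm2_le_energy X : norm X.2 <= energy_norm X.
Proof.
rewrite -[leLHS]ger0_norm ?norm_ge0// -sqrtr_sqr ler_wsqrtr//.
by rewrite lerDr sqr_ge0.
Qed.

Lemma coord1_le_energy X i : finite_energy X ->
  `|coord X.1 i| <= (freq i)^-1 * energy_norm X.
Proof.
move=> hX; rewrite ler_pdivlMl ?freq_gt0//.
apply: le_trans (norm1_le_energy X); apply: le_trans (coord_le_norm _ i).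
by rewrite coord_pow// normrM ger0_norm// ltW ?freq_gt0.
Qed.

Lemma coord2_le_energy X i : `|coord X.2 i| <= energy_norm X.
Proof. exact: le_trans (coord_le_norm _ i) (norm2_le_energy X). Qed.

Lemma finite_energy_congr X Y :
  same_coord X Y -> finite_energy X -> finite_energy Y.
Proof. by move=> [XY _]; exact: pow_dom_congr. Qed.

Lemma energy_norm_congr X Y : finite_energy X ->
  same_coord X Y -> energy_norm X = energy_norm Y.
Proof.
move=> hX XY; have hY := finite_energy_congr XY hX; case: XY => XY1 XY2.
rewrite /energy_norm (norm_coord XY2); congr (Num.sqrt (_ ^+ 2 + _)).
by apply: norm_coord => i; rewrite !coord_pow// XY1.
Qed.

Lemma finite_energyD X Y :
  finite_energy X -> finite_energy Y -> finite_energy (X + Y).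
Proof. exact: pow_domD. Qed.

Lemma finite_energyZ a X : finite_energy X -> finite_energy (a *: X).
Proof. exact: pow_domZ. Qed.

Lemma finite_energyB X Y :
  finite_energy X -> finite_energy Y -> finite_energy (X - Y).
Proof. exact: pow_domB. Qed.

Definition wave X : H * H := (X.2, - pow 1 X.1).

Definition wave_domain X := pow_dom 1 X.1 /\ pow_dom (1 / 2) X.2.

(** The group e^{tA} on the pairs of finite energy, equality of states being that
    of their coordinates. *)
Record wave_flow (E : R -> H * H -> H * H) : Prop := {
  flow_finite : forall t X, finite_energy X -> finite_energy (E t X) ;
  flow_linear : forall t a X Y, finite_energy X -> finite_energy Y ->
    same_coord (E t (a *: X + Y)) (a *: E t X + E t Y) ;
  flow_bounded : forall t, exists C : R, forall X, finite_energy X ->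
    energy_norm (E t X) <= C * energy_norm X ;
  flow0 : forall X, finite_energy X -> same_coord (E 0 X) X ;
  flowD : forall s t X, finite_energy X ->
    same_coord (E (s + t) X) (E s (E t X)) ;
  flow_generator : forall X Y, finite_energy X -> finite_energy Y ->
    (energy_norm (t^-1 *: (E t X - X) - Y) @[t --> 0^'] --> (0 : R)) <->
    (wave_domain X /\ same_coord (wave X) Y)
}.

Context (E : R -> H * H -> H * H) (E_flow : wave_flow E).

Let linear := flow_linear E_flow.
Let finite := flow_finite E_flow.

(** A state with null coordinates has zero energy; boundedness gives its image
    zero energy, hence null coordinates. *)
Lemma flow_congr t X Y : finite_energy X -> same_coord X Y ->
  same_coord (E t X) (E t Y).
Proof.
move=> hX XY; have hY := finite_energy_congr XY hX.
have [C hC] := flow_bounded E_flow t.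
have hYX : finite_energy (-1 *: Y + X).
  by apply: finite_energyD => //; exact: finite_energyZ.
have h0 : energy_norm (-1 *: Y + X) = 0.
  rewrite (@energy_norm_congr _ 0)//; last first.
    by case: XY => XY1 XY2; split => i; rewrite !coordE ?XY1 ?XY2; ring.
  rewrite /energy_norm norm0 (_ : norm _ = 0) ?expr0n ?addr0 ?sqrtr0//=.
  rewrite -[RHS](@norm0 _ H); apply: norm_coord => i.
  by rewrite coord_pow ?coord0 ?mulr0//; exact: pow_dom0.
have E0 : energy_norm (E t (-1 *: Y + X)) = 0.
  apply/eqP; rewrite eq_le energy_norm_ge0 andbT.
  by apply: le_trans (hC _ hYX) _; rewrite h0 mulr0.
have [L1 L2] := linear t (-1) hY hX.
split => i; apply/eqP; rewrite -subr_eq0 -normr_eq0 eq_le normr_ge0 andbT.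
  have := coord1_le_energy i (finite t hYX); rewrite E0 mulr0 L1 !coordE.
  by rewrite mulN1r addrC.
have := coord2_le_energy (E t (-1 *: Y + X)) i; rewrite E0 L2 !coordE.
by rewrite mulN1r addrC.
Qed.

Lemma wave_finite X : wave_domain X -> finite_energy (wave X).
Proof. by case. Qed.

Lemma flowZ t a X : finite_energy X -> same_coord (E t (a *: X)) (a *: E t X).
Proof.
move=> hX; have h0 : finite_energy (0 : H * H) by exact: pow_dom0.
have [Z1 Z2] := linear t (-1) h0 h0; rewrite scaler0 addr0 in Z1 Z2.
have [A1 A2] := linear t a hX h0; rewrite addr0 in A1 A2.
split => i; [rewrite A1|rewrite A2]; rewrite !coordE.
  by have := Z1 i; rewrite !coordE; lra.
by have := Z2 i; rewrite !coordE; lra.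
Qed.

Lemma flowB t X Y : finite_energy X -> finite_energy Y ->
  same_coord (E t (X - Y)) (E t X - E t Y).
Proof.
move=> hX hY; have [A1 A2] := linear t (-1) hY hX.
have [B1 B2] : same_coord (E t (X - Y)) (E t (-1 *: Y + X)).
  apply: flow_congr; first exact: finite_energyB.
  by split => i; rewrite !coordE; ring.
by split => i; [rewrite B1 A1|rewrite B2 A2]; rewrite !coordE; ring.
Qed.

(** Since [E] is a group of bounded operators, the difference quotient at time
    [t] is the image under [E t] of the one at time 0. *)
Lemma flow_quotient t X : finite_energy X -> wave_domain X ->
  energy_norm (h^-1 *: (E h (E t X) - E t X) - E t (wave X))
    @[h --> 0^'] --> (0 : R).
Proof.
move=> hX dX; have hwX := wave_finite dX.
have [C hC] := flow_bounded E_flow t.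
have hEX h : finite_energy (E h X - X) by apply: finite_energyB => //; exact: finite.
have hq h : finite_energy (h^-1 *: (E h X - X)) by exact: finite_energyZ.
have fin h : finite_energy (h^-1 *: (E h X - X) - wave X) by exact: finite_energyB.
have commute h : same_coord
    (E t (h^-1 *: (E h X - X) - wave X))
    (h^-1 *: (E h (E t X) - E t X) - E t (wave X)).
  have [A1 A2] := flowB t (hq h) hwX.
  have [B1 B2] := flowZ t h^-1 (hEX h).
  have [C1 C2] := flowB t (finite h hX) hX.
  have [D1 D2] := flowD E_flow t h hX.
  have [F1 F2] := flowD E_flow h t hX.
  split => i; [rewrite A1|rewrite A2]; rewrite !coordE.
    by rewrite B1 !coordE C1 !coordE -D1 -F1 (addrC t h).
  by rewrite B2 !coordE C2 !coordE -D2 -F2 (addrC t h).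
have lim : energy_norm (h^-1 *: (E h X - X) - wave X) @[h --> 0^'] --> (0 : R).
  by apply/(flow_generator E_flow hX hwX).
apply: (cvg_of_bound (b := fun h : R => C * energy_norm (h^-1 *: (E h X - X) - wave X))).
  move=> h; rewrite subr0 ger0_norm ?energy_norm_ge0//.
  rewrite -(energy_norm_congr _ (commute h)); last exact: finite.
  exact: hC.
exact: cvg_mul0.
Qed.

Lemma flow_domain t X : finite_energy X -> wave_domain X ->
  wave_domain (E t X) /\ same_coord (wave (E t X)) (E t (wave X)).
Proof.
move=> hX dX; apply/(flow_generator E_flow (finite t hX)).
  exact/finite/wave_finite.
exact: flow_quotient.
Qed.

Lemma flow_derive t X i : finite_energy X -> wave_domain X ->
  is_derive t 1 (fun s => coord (E s X).1 i) (coord (E t X).2 i) /\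
  is_derive t 1 (fun s => coord (E s X).2 i)
    (- (eigval H i * coord (E t X).1 i)).
Proof.
move=> hX dX; have [dEX [W1 W2]] := flow_domain t hX dX.
have lim := flow_quotient t hX dX.
have fin h : finite_energy (h^-1 *: (E h (E t X) - E t X) - E t (wave X)).
  apply: finite_energyB; last exact/finite/wave_finite.
  apply: finite_energyZ; apply: finite_energyB; last exact: finite.
  by apply: finite; exact: finite.
have eqD h := flowD E_flow h t hX.
split; apply: is_derive_of_quotient.
- apply: (cvg_of_bound (b := fun h : R => (freq i)^-1 *
    energy_norm (h^-1 *: (E h (E t X) - E t X) - E t (wave X)))).
    move=> h; have := coord1_le_energy i (fin h); rewrite !coordE.
    by rewrite -W1 (eqD h).1.
  exact: cvg_mul0.
- apply: (cvg_of_bound (b := fun h : R =>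
    energy_norm (h^-1 *: (E h (E t X) - E t X) - E t (wave X)))) => // h.
  have := coord2_le_energy (h^-1 *: (E h (E t X) - E t X) - E t (wave X)) i.
  rewrite !coordE -W2 (eqD h).2 /wave/= coordN coord_pow; last exact: dEX.1.
  by rewrite powRr1// ltW// eigval_gt0.
Qed.

Definition rotated t X i :=
  (cos (freq i * t) * coord X.1 i + sin (freq i * t) / freq i * coord X.2 i,
   - freq i * sin (freq i * t) * coord X.1 i + cos (freq i * t) * coord X.2 i).

Lemma flow_rotation_domain t X i : finite_energy X -> wave_domain X ->
  (coord (E t X).1 i, coord (E t X).2 i) = rotated t X i.
Proof.
move=> hX dX; have [e1 e2] := flow0 E_flow hX.
have da (s : R) := (flow_derive s i hX dX).1.
have db (s : R) : is_derive s 1 (fun s => coord (E s X).2 i)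
    (- (freq i ^+ 2 * coord (E s X).1 i)).
  by rewrite sqr_freq; have [] := flow_derive s i hX dX.
have [A B] := harmonic_solution (freq_neq0 i) da db t.
by rewrite /rotated A B e1 e2.
Qed.

Definition truncate X n := (modes (coord X.1) n : H, modes (coord X.2) n : H).

Lemma truncate_domain X n : wave_domain (truncate X n).
Proof. by split; exact: modes_pow_dom. Qed.

Lemma truncate_finite X n : finite_energy (truncate X n).
Proof. exact: modes_pow_dom. Qed.

Lemma truncate_cvg X : finite_energy X ->
  energy_norm (X - truncate X n) @[n --> \oo] --> (0 : R).
Proof.
move=> hX.
apply: (cvg_of_bound (b := fun n => norm (modes (fun i =>
    eigval H i `^ (1 / 2) * coord X.1 i) n - pow (1 / 2) X.1) +
  norm (modes (coord X.2) n - X.2))); last first.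
  rewrite -[X in _ --> X]addr0; apply: cvgD; last exact: modes_cvg.
  exact: powP hX.
move=> n; rewrite subr0 ger0_norm ?energy_norm_ge0//.
have -> : norm (modes (fun i => eigval H i `^ (1 / 2) * coord X.1 i) n -
    pow (1 / 2) X.1) = norm (pow (1 / 2) (X - truncate X n).1).
  rewrite -normN; apply: norm_coord => i.
  rewrite coord_pow; last by apply: finite_energyB => //; exact: truncate_finite.
  rewrite !coordE !coord_modes coord_pow//.
  by case: ifP => _; ring.
rewrite -(normN (_ - X.2)) opprB; exact: energy_norm_le.
Qed.

(** The group is given only through its generator. On the domain of the
    generator the coordinates solve the equation of a harmonic oscillator of
    frequency [freq i]; a general state is the limit of its truncations, which
    are in the domain, and [E t] is bounded. *)
Lemma flow_rotation t X i : finite_energy X ->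
  (coord (E t X).1 i, coord (E t X).2 i) = rotated t X i.
Proof.
move=> hX; have [C hC] := flow_bounded E_flow t.
have hT n := truncate_finite X n.
have hXT n : finite_energy (X - truncate X n) by exact: finite_energyB.
have rotT n : (i < n)%N ->
    (coord (E t (truncate X n)).1 i, coord (E t (truncate X n)).2 i) = rotated t X i.
  move=> lin; rewrite flow_rotation_domain//; last exact: truncate_domain.
  by rewrite /rotated /= !coord_modes lin.
have lim := truncate_cvg hX.
have cvg1 : coord (E t (truncate X n)).1 i @[n --> \oo] --> coord (E t X).1 i.
  apply: (cvg_of_bound (b := fun n => (freq i)^-1 * (C * energy_norm (X - truncate X n)))).
    move=> n; have := coord1_le_energy i (finite t (hXT n)).
    rewrite (flowB t hX (hT n)).1 !coordE distrC => /le_trans; apply.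
    by rewrite ler_pM2l ?invr_gt0 ?freq_gt0//; exact: hC.
  by apply: cvg_mul0; exact: cvg_mul0.
have cvg2 : coord (E t (truncate X n)).2 i @[n --> \oo] --> coord (E t X).2 i.
  apply: (cvg_of_bound (b := fun n => C * energy_norm (X - truncate X n))).
    move=> n; have := coord2_le_energy (E t (X - truncate X n)) i.
    rewrite (flowB t hX (hT n)).2 !coordE distrC => /le_trans; apply; exact: hC.
  exact: cvg_mul0.
rewrite [RHS]surjective_pairing; congr pair.
  apply: (cvg_unique _ cvg1) => //; apply: cvg_near_cst; exists i.+1 => // n /= lin.
  by have [] := rotT n lin.
apply: (cvg_unique _ cvg2) => //; apply: cvg_near_cst; exists i.+1 => // n /= lin.
by have [] := rotT n lin.
Qed.

(** Parseval's identity reduces the balance of the whole step to one eigenmode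
    at a time. The term [2 * dot w (u' - u)] is twice the work of the force
    [w]. *)
Lemma energy_balance u v u' v' w y :
  pow_dom (1 / 2) u -> pow_dom (1 / 2) u' ->
  (forall i, eigval H i * coord u' i ^+ 2 + coord v' i ^+ 2 +
      2 * coord w i * (coord u' i - coord u i) =
    eigval H i * coord u i ^+ 2 + (coord v i + coord y i) ^+ 2) ->
  norm (pow (1 / 2) u') ^+ 2 + norm v' ^+ 2 + 2 * dot w (u' - u) =
  norm (pow (1 / 2) u) ^+ 2 + norm (v + y) ^+ 2.
Proof.
move=> hu hu' bal; rewrite !sqr_norm.
have L : \sum_(i < n) eigval H i * (coord u' i * coord u' i) +
    \sum_(i < n) coord v' i * coord v' i +
    2 * \sum_(i < n) coord w i * coord (u' - u) i @[n --> \oo] -->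
    dot (pow (1 / 2) u') (pow (1 / 2) u') + dot v' v' + 2 * dot w (u' - u).
  apply: cvgD; last by apply: cvgMr; exact: parseval.
  by apply: cvgD; [exact: dot_pow|exact: parseval].
have M : \sum_(i < n) eigval H i * (coord u i * coord u i) +
    \sum_(i < n) coord (v + y) i * coord (v + y) i @[n --> \oo] -->
    dot (pow (1 / 2) u) (pow (1 / 2) u) + dot (v + y) (v + y).
  by apply: cvgD; [exact: dot_pow|exact: parseval].
apply: (cvg_unique _ L) => //; apply: cvg_trans M; apply: near_eq_cvg.
apply: nearW => n; rewrite mulr_sumr -!big_split; apply: eq_bigr => i _.
by have := bal i; rewrite /= !coordE; lra.
Qed.

(** In a mode of eigenvalue lam, [(u', v')] is the rotation of [(u, v + y)] about
    the equilibrium (- w / lam, 0) of the oscillator under the constant force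
    [- w], so the distance to this equilibrium in the energy norm is
    preserved. *)
Lemma exponential_balance t u v u' v' w y Z :
  pow_dom (1 / 2) u -> pow_dom (1 / 2) u' -> wave_domain Z ->
  same_coord (wave Z) (E t (0, - w) - (0, - w)) ->
  same_coord (u', v') (E t (u, v) + Z + E t (0, y)) ->
  norm (pow (1 / 2) u') ^+ 2 + norm v' ^+ 2 + 2 * dot w (u' - u) =
  norm (pow (1 / 2) u) ^+ 2 + norm (v + y) ^+ 2.
Proof.
move=> hu hu' dZ [W1 W2] [S1 S2]; apply: energy_balance => // i.
have h0 z : finite_energy (0, z) by exact: pow_dom0.
have [E1 E2] := flow_rotation t i (hu : finite_energy (u, v)).
have [F1 F2] := flow_rotation t i (h0 y).
have [G1 G2] := flow_rotation t i (h0 (- w)).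
have := W1 i; have := W2 i; have := S1 i; have := S2 i.
rewrite /wave /= !coordE coord_pow; last exact: dZ.1.
rewrite E1 E2 F1 F2 G1 G2 powRr1 ?ltW ?eigval_gt0// -sqr_freq /= !coordE.
set om := freq i; set c := cos _; set s := sin _ => -> -> z1 ->.
have om0 : om != 0 by exact: freq_neq0.
have cs : c ^+ 2 = 1 - s ^+ 2 by rewrite -(cos2Dsin2 (om * t)) addrK.
have {}z1 : coord Z.1 i = (c - 1) * coord w i / om ^+ 2.
  apply: (mulfI (x := om ^+ 2)); first by rewrite expf_neq0.
  have -> : om ^+ 2 * coord Z.1 i = (c - 1) * coord w i by lra.
  by field.
rewrite z1.
transitivity ((s ^+ 2 + c ^+ 2) *
  (om ^+ 2 * (coord u i + coord w i / om ^+ 2) ^+ 2 + (coord v i + coord y i) ^+ 2)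
  - coord w i ^+ 2 / om ^+ 2 - 2 * coord w i * coord u i); first by field.
by rewrite cs; field.
Qed.

End wave_equation.

(** In each mode the squares of [u'] and [u], and those of [v'] and [v + y], differ by
    a difference times a sum, and the midpoint rule expresses each difference
    by the other sum. *)
Lemma midpoint_balance {R : realType} {H : spectral R} (t : R) (u v u' v' w y : H) :
  pow_dom (1 / 2) u -> pow_dom (1 / 2) u' -> pow_dom 1 (u + u') ->
  coord u' =1 coord (u + (t / 2) *: (v + v') + (t / 2) *: y) ->
  coord v' =1 coord (v - (t / 2) *: pow 1 (u + u') - t *: w + y) ->
  norm (pow (1 / 2) u') ^+ 2 + norm v' ^+ 2 + 2 * dot w (u' - u) =
  norm (pow (1 / 2) u) ^+ 2 + norm (v + y) ^+ 2.
Proof.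
move=> hu hu' huu eu ev; apply: energy_balance => // i.
have := eu i; have := ev i; rewrite !coordE coord_pow//.
rewrite powRr1 ?ltW ?eigval_gt0// coordD.
set l := eigval H i => V U.
have -> : coord v' i ^+ 2 = (coord v i + coord y i) ^+ 2 +
    (coord v' i - (coord v i + coord y i)) * (coord v' i + (coord v i + coord y i)) by ring.
have dV : coord v' i - (coord v i + coord y i) =
    - (t / 2 * (l * (coord u i + coord u' i))) - t * coord w i by lra.
have dU : coord u' i - coord u i = t / 2 * (coord v i + coord y i + coord v' i) by lra.
have -> : l * coord u' i ^+ 2 = l * coord u i ^+ 2 +
    l * (coord u' i + coord u i) * (coord u' i - coord u i) by ring.
by rewrite dU dV; field.
Qed.

(** * One step from a random state *)

Lemma measurable_dot (R : realType) (H : spectral R) d (T : measurableType d)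
    (x z : T -> H) :
  (forall l, measurable_fun setT (fun t => coord (x t) l)) ->
  (forall l, measurable_fun setT (fun t => coord (z t) l)) ->
  measurable_fun setT (fun t => dot (x t) (z t)).
Proof.
move=> mx mz; apply: (@measurable_fun_cvg _ _ _ setT
  (fun n t => \sum_(l < n) coord (x t) l * coord (z t) l)).
- by move=> n; apply: measurable_sum => l; exact: measurable_funM.
- by move=> t _; exact: parseval.
Qed.

Lemma sigma_algebra_measurable_wrtP (R : realType) dW (Om : measurableType dW)
    (G : set (set Om)) (X : Om -> R) : sigma_algebra setT G ->
  measurable_fun setT (X : g_sigma_algebraType G -> R) <-> measurable_wrt G X.
Proof. by move=> sG; rewrite measurable_wrtP sigma_algebra_idE. Qed.

Section one_step.
Context {R : realType} {dW : measure_display} {Om : measurableType dW}.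
Context (P : probability Om R) (tau T : R) (b : nat -> Om -> R).
Context (noise : white_noise P tau b) (tau_gt0 : 0 < tau) (tauT : tau <= T).
Context (past future : set (set Om)).
Context (sigma_past : sigma_algebra setT past).
Context (sigma_future : sigma_algebra setT future).
Context (past_measurable : past `<=` measurable).
Context (future_measurable : future `<=` measurable).
Context (independence : indep2 P past future).
Context (noise_future : forall k, measurable_wrt future (b k)).
Context {H : spectral R}.

(** The state is known before the step and the noise is independent of it, so
    the inequality for a frozen state may be averaged over the states. *)
Lemma expected_increment (s : Om -> R) (v : Om -> H) (a : nat -> Om -> H) (C0 : R) n m :
  0 <= C0 -> measurable_wrt past s ->
  (forall l, measurable_wrt past (fun w => coord (v w) l)) ->
  (forall k l, measurable_wrt past (fun w => coord (a k w) l)) ->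
  (forall w, 0 < s w) -> (forall w, dot (v w) (v w) <= 2 * s w) ->
  (forall w, \sum_(k < n) dot (a k w) (a k w) <= C0 * s w) ->
  (\int[P]_w ((s w + dot (v w) (noise_vector b (a ^~ w) n w) +
      dot (noise_vector b (a ^~ w) n w) (noise_vector b (a ^~ w) n w) / 2) ^+ m.+1)%:E
   <= (1 + growth_cst T C0 m * tau)%:E * \int[P]_w (s w ^+ m.+1)%:E)%E.
Proof.
move=> C00 ms mv ma s0 vs aC; pose G := g_sigma_algebraType past.
pose K := g_sigma_algebraType future.
have msG : measurable_fun setT (s : G -> R) by exact/sigma_algebra_measurable_wrtP.
have mvG l : measurable_fun setT ((fun w => coord (v w) l) : G -> R).
  exact/sigma_algebra_measurable_wrtP.
have maG k l : measurable_fun setT ((fun w => coord (a k w) l) : G -> R).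
  exact/sigma_algebra_measurable_wrtP.
have mbK k : measurable_fun setT (b k : K -> R) by exact/sigma_algebra_measurable_wrtP.
have mva k : measurable_fun setT ((fun w => dot (v w) (a k w)) : G -> R).
  exact: (@measurable_dot _ _ _ G).
have maa k l : measurable_fun setT ((fun w => dot (a k w) (a l w)) : G -> R).
  exact: (@measurable_dot _ _ _ G).
pose y (z : G * K) : H := noise_vector b (a ^~ z.1) n z.2.
pose Phi (z : G * K) := (((s z.1 + dot (v z.1) (y z) + dot (y z) (y z) / 2) ^+ m.+1)%:E)%E.
have m1 (h : G -> R) : measurable_fun setT h -> measurable_fun setT (fun z : G * K => h z.1).
  by move=> mh; exact: (measurableT_comp mh).
have m2 (h : K -> R) : measurable_fun setT h -> measurable_fun setT (fun z : G * K => h z.2).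
  by move=> mh; exact: (measurableT_comp mh).
have mvy : measurable_fun setT (fun z : G * K => dot (v z.1) (y z)).
  under eq_fun do rewrite dot_noise_vector.
  by apply: measurable_sum => k; apply: measurable_funM; [exact: m1 (mva k)|exact: m2].
have myy : measurable_fun setT (fun z : G * K => dot (y z) (y z)).
  under eq_fun do rewrite {1}/y dot_suml.
  apply: measurable_sum => k.
  under eq_fun do rewrite dotZl dot_noise_vector.
  apply: measurable_funM; first exact: m2.
  apply: measurable_sum => l.
  by apply: measurable_funM; [exact: m1 (maa k l)|exact: m2].
have mPhi : measurable_fun setT Phi.
  apply/measurable_EFinP/measurable_funX/measurable_funD; last exact: measurable_funM.
  by apply: measurable_funD => //; exact: m1.
have base0 z : 0 <= s z.1 + dot (v z.1) (y z) + dot (y z) (y z) / 2.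
  have := dot_ge0 (v z.1 + y z); rewrite dot_sqrD; have := vs z.1; lra.
have Phi0 z : (0 <= Phi z)%E by rewrite lee_fin exprn_ge0.
have pastE : <<s past >> = past by exact: smallest_id.
have futureE : <<s future >> = future by exact: smallest_id.
have [|||//|//|mI ->] := @decoupling_sigma _ _ _ P past future Phi.
- by rewrite pastE.
- by rewrite futureE.
- by rewrite pastE futureE.
have msO : measurable_fun setT s.
  by move=> _ B mB; rewrite setTI; apply: past_measurable; exact: ms.
have T0 : 0 < T by exact: lt_le_trans tauT.
have K0 : 0 <= 1 + growth_cst T C0 m * tau.
  by rewrite addr_ge0// mulr_ge0 ?growth_cst_ge0// ltW.
have s00 w : 0 <= s w by exact: ltW.
rewrite -ge0_integralZl//; last 2 first.
- exact/measurable_EFinP/measurable_funX.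
- by move=> w _; rewrite lee_fin exprn_ge0.
apply: ge0_le_integral => //.
- by move=> w _; exact: integral_ge0.
- by apply: emeasurable_funM => //; exact/measurable_EFinP/measurable_funX.
- move=> w _; rewrite -EFinM.
  exact: (@frozen_increment _ _ _ _ _ _ _ noise tau_gt0 tauT _ _ (a ^~ w) _ _ _ m
    (s0 w) (vs w) (aC w)).
Qed.

(** The full noise is a limit of truncations, for which the bound is uniform;
    Fatou's lemma passes to the limit. *)
Lemma expected_step (s s' : Om -> R) (v : Om -> H) (a : nat -> Om -> H) (C0 : R) m :
  0 <= C0 -> measurable_wrt past s -> measurable_fun setT s' ->
  (forall l, measurable_wrt past (fun w => coord (v w) l)) ->
  (forall k l, measurable_wrt past (fun w => coord (a k w) l)) ->
  (forall w, 0 < s w) -> (forall w, dot (v w) (v w) <= 2 * s w) ->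
  (forall n w, \sum_(k < n) dot (a k w) (a k w) <= C0 * s w) ->
  {ae P, forall w, s w + dot (v w) (noise_vector b (a ^~ w) n w) +
      dot (noise_vector b (a ^~ w) n w) (noise_vector b (a ^~ w) n w) / 2
      @[n --> \oo] --> s' w} ->
  (\int[P]_w (s' w ^+ m.+1)%:E <=
    (1 + growth_cst T C0 m * tau)%:E * \int[P]_w (s w ^+ m.+1)%:E)%E.
Proof.
move=> C00 ms ms' mv ma s0 vs aC lim.
have sub (X : Om -> R) (G : set (set Om)) : G `<=` measurable ->
    measurable_wrt G X -> measurable_fun setT X.
  by move=> mG mX _ B mB; rewrite setTI; apply: mG; exact: mX.
apply: (@fatou_le _ _ _ P (fun n w => (s w + dot (v w) (noise_vector b (a ^~ w) n w) +
      dot (noise_vector b (a ^~ w) n w) (noise_vector b (a ^~ w) n w) / 2) ^+ m.+1)).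
- move=> n; apply/measurable_funX.
  have mdot (x z : Om -> H) : (forall l, measurable_wrt past (fun w => coord (x w) l)) ->
      (forall l, measurable_wrt past (fun w => coord (z w) l)) ->
      measurable_fun setT (fun w => dot (x w) (z w)).
    by move=> mx mz; apply: measurable_dot => l; apply: sub past_measurable _.
  have mb k : measurable_fun setT (b k) by exact: noise_measurable noise k.
  apply: measurable_funD; last first.
    apply: measurable_funM => //.
    under eq_fun do rewrite {1}/noise_vector dot_suml.
    apply: measurable_sum => k.
    under eq_fun do rewrite dotZl dot_noise_vector.
    apply: measurable_funM => //; apply: measurable_sum => l.
    by apply: measurable_funM => //; exact: mdot.
  apply: measurable_funD; first exact: sub past_measurable ms.
  under eq_fun do rewrite dot_noise_vector.
  apply: measurable_sum => k.
  by apply: measurable_funM => //; exact: mdot.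
- exact: measurable_funX.
- move=> n w; apply: exprn_ge0.
  have := dot_ge0 (v w + noise_vector b (a ^~ w) n w); rewrite dot_sqrD.
  have := vs w; lra.
- by apply: filterS lim => w; exact: cvg_expn.
- by move=> n; exact: expected_increment.
Qed.

End one_step.

(** * Measurability of locally Lipschitz functions *)

Section meval2.
Context {R : realType} (b : mpoly.mpoly 2 R).

Lemma meval2E x y : meval2 b x y =
  \sum_(m <- mpoly.msupp b) mpoly.mcoeff m b *
    \prod_(i < 2) (if i == ord0 then x else y) ^+ (mpoly.fun_of_multinom m i).
Proof. by rewrite /meval2 mpoly.mevalE. Qed.

Lemma continuous_meval2 y : continuous (meval2 b ^~ y).
Proof.
move=> x; rewrite (_ : meval2 b ^~ y = fun x => \sum_(m <- mpoly.msupp b) mpoly.mcoeff m b *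
    \prod_(i < 2) (if i == ord0 then x else y) ^+ (mpoly.fun_of_multinom m i)).
  apply: cvg_sumr => m; apply: cvgM; first exact: cvg_cst.
  under eq_fun do rewrite 2!big_ord_recl big_ord0 mulr1.
  rewrite 2!big_ord_recl big_ord0 mulr1 /=.
  by apply: cvgM; [exact: cvg_expn|exact: cvg_cst].
by apply/funext => z; exact: meval2E.
Qed.

End meval2.

Section lipschitz.
Context {R : realType} {H : spectral R}.
Implicit Types (x y : H).

Definition norm1 x := norm (pow (1 / 2) x).

Lemma cvg_norm1 (v : nat -> H) x : (forall n, pow_dom (1 / 2) (v n)) ->
  pow_dom (1 / 2) x ->
  norm1 (v n - x) @[n --> \oo] --> 0 -> norm1 (v n) @[n --> \oo] --> norm1 x.
Proof.
move=> hv hx lim; apply: cvg_norm.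
suff -> : (fun n => norm (pow (1 / 2) (v n) - pow (1 / 2) x)) = (fun n => norm1 (v n - x)).
  by [].
apply/funext => n; apply: norm_coord => i.
by rewrite coordB !coord_pow// ?coordB ?mulrBr//; exact: pow_domB.
Qed.

Lemma norm1_modes c n : norm1 (modes c n) = Num.sqrt (\sum_(i < n) eigval H i * c i ^+ 2).
Proof.
rewrite /norm1 /norm; congr Num.sqrt; apply: dot_limE.
apply: cvg_near_cst; exists n => // N /= nN.
transitivity (\sum_(i < N) if (i < n)%N then eigval H i * c i ^+ 2 else 0).
  apply: eq_bigr => i _; rewrite coord_pow; last exact: modes_pow_dom.
  rewrite mulrACA pow_half coord_modes; case: ifP => _; last by rewrite !mulr0.
  by rewrite expr2.
rewrite -big_mkcond/=.
by rewrite (big_ord_widen _ (fun i => eigval H i * c i ^+ 2) nN).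
Qed.

Lemma cvg_norm1_modes (T : Type) (F : set_system T) {FF : Filter F}
  (c : T -> nat -> R) (l : nat -> R) n : (forall i, c t i @[t --> F] --> l i) ->
  norm1 (modes (c t) n) @[t --> F] --> norm1 (modes l n).
Proof.
move=> cl; under eq_fun do rewrite norm1_modes; rewrite norm1_modes.
apply: (cvg_continuous (@sqrt_continuous R)).
apply: cvg_sumr => i; apply: cvgM; first exact: cvg_cst.
exact: cvg_expn.
Qed.

Definition row_seq n (x : 'rV[R]_n) (i : nat) : R :=
  if insub i is Some j then x ord0 j else 0.

Lemma continuous_row_seq n i : continuous (fun x : 'rV[R]_n.+1 => row_seq x i).
Proof.
rewrite /row_seq; case: (insub i : option 'I_n.+1) => [j|]; first exact: coord_continuous.
exact: cst_continuous.
Qed.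

Context (psi : H -> R) (L : R -> R -> R) (L_continuous : forall r, continuous (L ^~ r)).
Context (psi_lip : forall x y, pow_dom (1 / 2) x -> pow_dom (1 / 2) y ->
  `|psi x - psi y| <= L (norm1 x) (norm1 y) * norm1 (x - y)).

(** The constant [L (norm1 (v n)) (norm1 x)] stays bounded because it
    converges. *)
Lemma lipschitz_cvg (v : nat -> H) x : (forall n, pow_dom (1 / 2) (v n)) ->
  pow_dom (1 / 2) x ->
  norm1 (v n - x) @[n --> \oo] --> 0 -> psi (v n) @[n --> \oo] --> psi x.
Proof.
move=> hv hx lim; apply: (cvg_of_bound (b := fun n =>
  L (norm1 (v n)) (norm1 x) * norm1 (v n - x))); first by move=> n; exact: psi_lip.
rewrite -[X in _ --> X](mulr0 (L (norm1 x) (norm1 x))).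
apply: cvgM => //.
exact: (cvg_continuous (@L_continuous (norm1 x)) (cvg_norm1 hv hx lim)).
Qed.

Lemma continuous_lipschitz_modes n :
  continuous (fun r : 'rV[R]_n.+1 => psi (modes (row_seq r) n.+1)).
Proof.
move=> r0; set N0 := norm1 (modes (row_seq r0) n.+1).
have N0_cvg : norm1 (modes (row_seq r) n.+1) @[r --> r0] --> N0.
  apply: (@cvg_norm1_modes _ (nbhs r0) _ (fun r => row_seq r)) => i.
  exact: continuous_row_seq.
apply: (@cvg_of_bound _ _ (nbhs r0) _ _ (fun r =>
  L (norm1 (modes (row_seq r) n.+1)) N0 *
  norm1 (modes (fun i => row_seq r i - row_seq r0 i) n.+1))).
  move=> r; apply: le_trans (psi_lip _ _) _; try exact: modes_pow_dom.
  rewrite (_ : modes (fun i => row_seq r i - row_seq r0 i) n.+1 =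
    modes (row_seq r) n.+1 - modes (row_seq r0) n.+1)//.
  by rewrite /modes -sumrB; apply: eq_bigr => i _; rewrite scalerBl.
rewrite -[X in _ --> X](mulr0 (L N0 N0)); apply: cvgM.
  exact: (cvg_continuous (@L_continuous N0) N0_cvg).
have z0 : norm1 (modes (fun=> 0) n.+1) = 0.
  by rewrite norm1_modes big1 ?sqrtr0// => i _; rewrite expr0n mulr0.
rewrite -[X in _ --> X]z0.
apply: (@cvg_norm1_modes _ (nbhs r0) _ (fun r i => row_seq r i - row_seq r0 i)) => i.
by apply/subr_cvg0; exact: continuous_row_seq.
Qed.

Lemma measurable_continuous_rV n (phi : 'rV[R]_n -> R) :
  continuous phi -> measurable_fun setT phi.
Proof.
move=> cphi; apply: (measurability _ (RGenOInfty.measurableE R)) => _ [_ [r ->] <-].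
rewrite setTI set_itvoy; apply: open_measurable_rV.
by apply: open_comp; [move=> x _; exact: cphi|exact: open_gt].
Qed.

(** At a truncation of [u t] the value of [psi] is a continuous function of
    finitely many measurable coordinates, and [psi (u t)] is the limit of these
    values. *)
Lemma measurable_lipschitz d (T : measurableType d) (u : T -> H) :
  (forall t, pow_dom (1 / 2) (u t)) ->
  (forall i, measurable_fun setT (fun t => coord (u t) i)) ->
  measurable_fun setT (fun t => psi (u t)).
Proof.
move=> hu mu; apply: (@measurable_fun_cvg _ _ _ setT
   (fun n t => psi (modes (coord (u t)) n.+1))).
  move=> n; pose X t := \row_(i < n.+1) coord (u t) i.
  have mX : measurable_fun setT X.
    by apply: measurable_rV => i; under eq_fun do rewrite mxE; exact: mu.
  have := measurableT_comp (measurable_continuous_rV (@continuous_lipschitz_modes n)) mX.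
  apply: eq_measurable_fun => t _ /=; congr psi.
  apply: eq_bigr => i _; congr (_ *: _).
  by rewrite /row_seq valK mxE.
move=> t _.
have := @lipschitz_cvg (fun n => modes (coord (u t)) n) (u t).
move=> /(_ (fun n => modes_pow_dom _ _ n) (hu t)) h.
have : psi (modes (coord (u t)) n) @[n --> \oo] --> psi (u t).
  apply: h; have hX : finite_energy (u t, 0 : H) by exact: hu.
  apply: (cvg_of_bound (b := fun n => energy_norm ((u t, 0) - truncate (u t, 0) n))).
    move=> n; rewrite subr0 ger0_norm ?norm_ge0//.
    apply: le_trans (norm1_le_energy _) => /=.
    rewrite /norm1 le_eqVlt; apply/orP; left; apply/eqP.
    rewrite -normN; apply: norm_coord => i.
    rewrite coordN !coord_pow ?coordB; try exact: pow_domB (hu t) (modes_pow_dom _ _ _).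
      by ring.
    exact: pow_domB (modes_pow_dom _ _ _) (hu t).
  exact: truncate_cvg.
by rewrite -cvg_shiftS.
Qed.

End lipschitz.

(** * The two schemes *)

Lemma modified_energy_arith (R : realType) (a1 a2 a3 a4 i1 i2 r r' : R) :
  a1 + a2 + 2 * ((r + r') * (r' - r)) = a3 + (a4 + 2 * i1 + i2) ->
  2^-1 * a1 + 2^-1 * a2 + r' ^+ 2 =
  2^-1 * a3 + 2^-1 * a4 + r ^+ 2 + i1 + i2 / 2.
Proof. lra. Qed.

Section concrete.
Context {R : realType} {d : nat} {O : polygonal_domain R d}.
Local Notation L2 := (L2 O).
Context (e : nat -> L2) (lam : nat -> R) (e_lam : dirichlet_eigenbasis e lam).
Local Notation H := (L2_spectral e_lam).

Lemma eqHHP (X Y : L2 * L2) : eqHH X Y <-> same_coord (H := H) X Y.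
Proof.
split=> -[h1 h2].
  exact: conj ((eqL2_coord e_lam X.1 Y.1).1 h1) ((eqL2_coord e_lam X.2 Y.2).1 h2).
exact: conj ((eqL2_coord e_lam X.1 Y.1).2 h1) ((eqL2_coord e_lam X.2 Y.2).2 h2).
Qed.

Lemma HHP (X : L2 * L2) : HH e lam X <-> finite_energy (H := H) X.
Proof. exact: (frac_domP e_lam (1 / 2) X.1). Qed.

Lemma wave_domP (X : L2 * L2) : wave_dom e lam X <-> wave_domain (H := H) X.
Proof.
split=> -[h1 h2].
  exact: conj ((frac_domP e_lam 1 X.1).1 h1) ((frac_domP e_lam (1 / 2) X.2).1 h2).
exact: conj ((frac_domP e_lam 1 X.1).2 h1) ((frac_domP e_lam (1 / 2) X.2).2 h2).
Qed.

Lemma wave_group_flow (E : R -> L2 * L2 -> L2 * L2) :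
  is_wave_group e lam E -> wave_flow (H := H) E.
Proof.
move=> gE; split.
- by move=> t X hX; apply: (HHP _).1; exact: wave_group_HH gE t X ((HHP X).2 hX).
- move=> t a X Y hX hY; apply: (eqHHP _ _).1.
  exact: wave_group_linear gE t a X Y ((HHP X).2 hX) ((HHP Y).2 hY).
- move=> t; have [C hC] := wave_group_bounded gE t; exists C => X hX.
  exact: hC X ((HHP X).2 hX).
- by move=> X hX; apply: (eqHHP _ _).1; exact: wave_group0 gE X ((HHP X).2 hX).
- move=> s t X hX; apply: (eqHHP _ _).1.
  exact: wave_groupD gE s t X ((HHP X).2 hX).
- move=> X Y hX hY.
  have [h1 h2] := wave_group_generator gE ((HHP X).2 hX) ((HHP Y).2 hY).
  split=> [/h1 [dX XY]|[dX XY]].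
    exact: conj ((wave_domP X).1 dX) ((eqHHP _ _).1 XY).
  exact: h2 (conj ((wave_domP X).2 dX) ((eqHHP _ _).2 XY)).
Qed.

(** The work of the nonlinear force over the step is exactly the increment of
    [q ^+ 2], by the update rule of [q]; so only the kick that the noise gives
    to the velocity changes the modified energy. *)
Lemma energy_step (E : R -> L2 * L2 -> L2 * L2) (f : L2 -> L2) (Ft : R -> R)
    (delta0 tau : R) s (uh u v u' v' y : L2) (q q' : R) :
  is_wave_group e lam E ->
  Hdot e lam 1 u -> Hdot e lam 1 u' ->
  q_step f Ft delta0 uh u u' q q' ->
  scheme_step e lam E f Ft delta0 s tau uh u v u' v' q q' y ->
  energy e lam u' v' q' = energy e lam u v q + ip v y + ip y y / 2.
Proof.
move=> gE0 hu0 hu0' hq hs; have gE := wave_group_flow gE0.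
have hu := (frac_domP e_lam (1 / 2) u).1 hu0.
have hu' := (frac_domP e_lam (1 / 2) u').1 hu0'.
pose w : L2 := sav_drift f Ft delta0 uh q q'.
suff bal : @norm R H (@pow R H (1 / 2) u') ^+ 2 + @norm R H v' ^+ 2 +
    2 * @dot R H w (u' - u) =
    @norm R H (@pow R H (1 / 2) u) ^+ 2 + @norm R H (v + y) ^+ 2.
  have work : @dot R H w (u' - u) = (q + q') * (q' - q).
    have work0 : ip w (u' - u) = (q + q') * (q' - q).
      by rewrite /w /sav_drift !ipZl hq invfM; ring.
    exact: work0.
  have vy : @norm R H (v + y) ^+ 2 = @norm R H v ^+ 2 + 2 * ip v y + ip y y.
    by rewrite !sqr_norm; exact: (@dot_sqrD R H v y).
  rewrite work vy in bal; exact: modified_energy_arith bal.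
case: s hs => [[hU hd hV]|[Z [hZ hAZ hX]]].
- have hL : coord (H := H) v' =1 @coord R H (v - (tau / 2) *: @pow R H 1 (u + u') - tau *: w + y).
    move=> i; apply: (etrans ((eqL2_coord e_lam _ _).1 hV i)).
    have -> : @coord R H (v + (tau / 2) *: Lap e lam (u + u') - tau *: w + y) i =
        @coord R H (v : H) i + (tau / 2) * - @coord R H (@pow R H 1 (u + u')) i
         - tau * @coord R H w i + @coord R H y i.
      by rewrite !(@coordD R H) !(@coordN R H) !(@coordZ R H) (@coordN R H).
    by rewrite !(@coordD R H) !(@coordN R H) !(@coordZ R H) mulrN.
  exact: (@midpoint_balance R H tau u v u' v' w y hu hu'
    ((frac_domP e_lam 1 (u + u')).1 hd) ((eqL2_coord e_lam _ _).1 hU) hL).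
- exact: (@exponential_balance R H _ gE tau u v u' v' w y Z hu hu'
    ((wave_domP Z).1 hZ) ((eqHHP _ _).1 hAZ) ((eqHHP _ _).1 hX)).
Qed.

End concrete.

(** * Hilbert-Schmidt norms *)

Section nneseries.
Context {R : realType}.
Implicit Types c : nat -> R.

Lemma partial_sum_le_nneseries c n : (forall k, 0 <= c k) ->
  (\sum_(0 <= k <oo) (c k)%:E < +oo)%E ->
  \sum_(k < n) c k <= fine (\sum_(0 <= k <oo) (c k)%:E)%E.
Proof.
move=> c0 fin; rewrite -lee_fin fineK; last first.
  by rewrite ge0_fin_numE//; apply: nneseries_ge0 => k _ _; rewrite lee_fin.
rewrite -sumEFin -(big_mkord predT (fun k => (c k)%:E)).
by apply: nneseries_lim_ge => k _; rewrite lee_fin.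
Qed.

Lemma nneseries_dominated c c' : (forall k, 0 <= c k <= c' k) ->
  (\sum_(0 <= k <oo) (c' k)%:E < +oo)%E ->
  (\sum_(0 <= k <oo) (c k)%:E < +oo)%E.
Proof.
move=> cc'; apply: le_lt_trans; apply: lee_nneseries => k _.
  by rewrite lee_fin; case/andP: (cc' k).
by rewrite lee_fin; case/andP: (cc' k).
Qed.

Lemma nneseries_lin2 c c' a : (forall k, 0 <= c k) -> (forall k, 0 <= c' k) -> 0 <= a ->
  (\sum_(0 <= k <oo) (c k)%:E < +oo)%E -> (\sum_(0 <= k <oo) (c' k)%:E < +oo)%E ->
  (\sum_(0 <= k <oo) (a * (c k + c' k))%:E < +oo)%E.
Proof.
move=> c0 c'0 a0 fc fc'.
under eq_eseriesr do rewrite EFinM EFinD.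
rewrite nneseriesZl//; last by move=> k _; rewrite -EFinD lee_fin addr_ge0.
rewrite nneseriesD//; try by move=> k _ _; rewrite lee_fin.
by apply: lte_mul_pinfty => //; rewrite ?lee_fin// lte_add_pinfty.
Qed.

End nneseries.

Section hilbert_schmidt.
Context {R : realType} {d : nat} {O : polygonal_domain R d}.
Local Notation L2 := (L2 O).
Context (e : nat -> L2) (lam : nat -> R) (e_lam : dirichlet_eigenbasis e lam).
Context (Qh : L2 -> L2).
Local Notation H := (L2_spectral e_lam).
Implicit Types G : L2 -> L2.

Lemma hs_partial_sum G n : (hs_sum e Qh G < +oo)%E ->
  \sum_(k < n) @dot R H (G (Qh (e k))) (G (Qh (e k))) <= hs_norm e Qh G ^+ 2.
Proof.
move=> fin; rewrite sqr_sqrtr; last first.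
  by apply/fine_ge0/nneseries_ge0 => k _ _; rewrite lee_fin sqr_ge0.
have := partial_sum_le_nneseries n (fun k => sqr_ge0 (norm2 (G (Qh (e k))))) fin.
apply: le_trans; apply: ler_sum => k _.
by rewrite sqr_norm2.
Qed.

Lemma norm_le_hs_norm G k : (hs_sum e Qh G < +oo)%E ->
  norm2 (G (Qh (e k))) <= hs_norm e Qh G.
Proof.
move=> fin; rewrite -(ler_pXn2r (n := 2))// ?nnegrE ?sqrtr_ge0//.
apply: le_trans (hs_partial_sum k.+1 fin).
rewrite big_ord_recr/= sqr_norm2 lerDr.
by apply: sumr_ge0 => i _; exact: (@dot_ge0 R H).
Qed.

Lemma hs_sumB G G' : (hs_sum e Qh G < +oo)%E -> (hs_sum e Qh G' < +oo)%E ->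
  (hs_sum e Qh (fun z => (G z - G' z)%R) < +oo)%E.
Proof.
move=> fin fin'; have h20 : (0 : R) <= 2 by [].
have := nneseries_lin2 (fun k => sqr_ge0 (norm2 (G (Qh (e k)))))
  (fun k => sqr_ge0 (norm2 (G' (Qh (e k))))) h20 fin fin'.
apply: nneseries_dominated => k; rewrite sqr_ge0/=.
exact: (@norm_sqrB_le R H).
Qed.

End hilbert_schmidt.

(** * Brownian increments *)

Section brownian.
Context {R : realType} {dW : measure_display} {Om : measurableType dW}.
Context (P : probability Om R) (F : R -> set (set Om)) (F_filtration : is_filtration F).
Context (beta : nat -> R -> Om -> R) (beta_bm : is_iid_brownian P F beta).

Lemma sigma_gen_sigma_algebra (S : set (Om -> R)) : sigma_algebra setT (sigma_gen S).
Proof. exact: smallest_sigma_algebra. Qed.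

Lemma sigma_gen_measurable (S : set (Om -> R)) :
  (forall X, S X -> measurable_fun setT X) -> sigma_gen S `<=` measurable.
Proof.
move=> mS; apply: smallest_sub; first exact: sigma_algebra_measurable.
move=> _ [X [SX [B mB ->]]]; rewrite -[X in measurable X]setTI.
exact: mS.
Qed.

Lemma measurable_wrt_sigma_gen (S : set (Om -> R)) X :
  S X -> measurable_wrt (sigma_gen S) X.
Proof.
by move=> SX B mB; apply: sub_sigma_algebra; exists X; split=> //; exists B.
Qed.

Lemma adapted_measurable t (X : Om -> R) : 0 <= t ->
  measurable_wrt (F t) X -> measurable_fun setT X.
Proof.
move=> t0 mX _ B mB; rewrite setTI.
by apply: (filtration_meas F_filtration t0); exact: mX.
Qed.

Lemma measurable_brownian k t : 0 <= t -> measurable_fun setT (beta k t).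
Proof. by move=> t0; apply: (adapted_measurable t0); exact: bm_adapted beta_bm k t t0. Qed.

(** Independence comes from that of the whole paths, the law of each increment
    from the definition of Brownian motion. *)
Lemma brownian_white_noise s t : 0 <= s -> s < t ->
  white_noise P (t - s) (fun k w => beta k t w - beta k s w).
Proof.
move=> s0 st; have t0 : 0 <= t by rewrite (le_trans s0)// ltW.
split=> [k|n a]; first by apply: measurable_funB; exact: measurable_brownian.
have ts0 : 0 <= t - s by rewrite subr_ge0 ltW.
rewrite -[X in expR (X / 2 * _)](sqr_sqrtr ts0).
pose G k := sigma_gen [set X | exists t, 0 <= t /\ X = beta k t].
apply: (@gaussian_sum_mgf _ _ _ _ _ G (fun k w => beta k t w - beta k s w)).
- by rewrite gt_eqF// sqrtr_gt0 subr_gt0.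
- by move=> k; exact: sigma_gen_sigma_algebra.
- move=> k; apply: sigma_gen_measurable => _ [r [r0 ->]].
  exact: measurable_brownian.
- exact: bm_indep beta_bm.
- move=> k; apply/measurable_wrtP; apply: measurable_funB; apply/measurable_wrtP.
    by apply: measurable_wrt_sigma_gen; exists t.
  by apply: measurable_wrt_sigma_gen; exists s.
- by move=> k B mB; exact: bm_gaussian beta_bm _ _ _ s0 st _ mB.
Qed.

End brownian.

(** * Moments of the energy along the schemes *)

Section measurable_states.
Context {R : realType} {dW : measure_display} {Om : measurableType dW}.
Context (G : set (set Om)) (sG : sigma_algebra setT G) {H : spectral R}.

Lemma measurable_wrt_energy (u v : Om -> H) (q : Om -> R) :
  (forall w, pow_dom (1 / 2) (u w)) ->
  (forall l, measurable_wrt G (fun w => coord (u w) l)) ->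
  (forall l, measurable_wrt G (fun w => coord (v w) l)) ->
  measurable_wrt G q ->
  measurable_wrt G (fun w => 1 + (2^-1 * norm (pow (1 / 2) (u w)) ^+ 2 +
    2^-1 * norm (v w) ^+ 2 + q w ^+ 2)).
Proof.
move=> hu mu mv mq; pose T := g_sigma_algebraType G.
have muT l : measurable_fun setT ((fun w => coord (u w) l) : T -> R).
  exact/sigma_algebra_measurable_wrtP.
have mvT l : measurable_fun setT ((fun w => coord (v w) l) : T -> R).
  exact/sigma_algebra_measurable_wrtP.
have mqT : measurable_fun setT (q : T -> R) by exact/sigma_algebra_measurable_wrtP.
apply/(sigma_algebra_measurable_wrtP _ sG).
apply: measurable_funD; first exact: measurable_cst.
apply: measurable_funD; last exact: measurable_funX.
apply: measurable_funD; apply: measurable_funM; try exact: measurable_cst.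
  under eq_fun do rewrite sqr_norm.
  by apply: (@measurable_dot _ _ _ T) => l; under eq_fun => w do rewrite coord_pow//;
    apply: measurable_funM.
by under eq_fun do rewrite sqr_norm; exact: (@measurable_dot _ _ _ T).
Qed.

End measurable_states.

Section numerical_solution.
Context {R : realType} {d : nat} {O : polygonal_domain R d}.
Local Notation L2 := (L2 O).
Context (e : nat -> L2) (lam : nat -> R) (e_lam : dirichlet_eigenbasis e lam).
Local Notation H := (L2_spectral e_lam).
Context (Qh : L2 -> L2) (g : L2 * ('I_d -> L2) -> L2 -> L2).
Context (g_hs : forall u w, Hdot e lam 1 u -> is_hilbert_schmidt e Qh (g (u, w))).

Lemma hs_sum_Theta u : Hdot e lam 1 u -> (hs_sum e Qh (g (Theta u)) < +oo)%E.
Proof. by move=> hu; exact: hs_finite (g_hs (Theta u).2 hu). Qed.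

(** The local Lipschitz continuity of [g] is what makes the coefficients
    measurable functions of the state. *)
Lemma measurable_wrt_coefficient (b3 : mpoly.mpoly 2 R)
    (g_lip : forall u u', Hdot e lam 1 u -> Hdot e lam 1 u' ->
      hs_norm e Qh (fun z => g (Theta u) z - g (Theta u') z) <=
      meval2 b3 (normHdot e lam 1 u) (normHdot e lam 1 u') *
      normHdot e lam 1 (u - u'))
    dW (Om : measurableType dW) (G : set (set Om)) (sG : sigma_algebra setT G)
    (u : Om -> L2) k l :
  (forall w, Hdot e lam 1 (u w)) ->
  (forall l, measurable_wrt G (fun w => @coord R H (u w) l)) ->
  measurable_wrt G (fun w => @coord R H (g (Theta (u w)) (Qh (e k))) l).
Proof.
move=> hu mu.
have lip (x y : H) : pow_dom (1 / 2) x -> pow_dom (1 / 2) y ->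
    `|@coord R H (g (Theta (x : L2)) (Qh (e k))) l - @coord R H (g (Theta (y : L2)) (Qh (e k))) l| <=
    meval2 b3 (norm1 x) (norm1 y) * norm1 (x - y).
  move=> hx hy.
  have hx' : Hdot e lam 1 x := (frac_domP e_lam (1 / 2) x).2 hx.
  have hy' : Hdot e lam 1 y := (frac_domP e_lam (1 / 2) y).2 hy.
  have h1 := @coord_le_norm R H (g (Theta (x : L2)) (Qh (e k)) - g (Theta (y : L2)) (Qh (e k))) l.
  have h2 := norm_le_hs_norm e_lam k (hs_sumB e_lam (hs_sum_Theta hx') (hs_sum_Theta hy')).
  have h3 := le_trans h1 (le_trans h2 (g_lip _ _ hx' hy')).
  by rewrite (@coordB R H) in h3.
have hu' w := (frac_domP e_lam (1 / 2) (u w)).1 (hu w).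
have mu' i : measurable_fun setT ((fun w => @coord R H (u w) i) : g_sigma_algebraType G -> R).
  exact: (sigma_algebra_measurable_wrtP _ sG).2 (mu i).
have := @measurable_lipschitz R H
  (fun x : H => @coord R H (g (Theta (x : L2)) (Qh (e k))) l) (meval2 b3)
  (@continuous_meval2 R b3) lip _ (g_sigma_algebraType G) u hu' mu'.
exact: (sigma_algebra_measurable_wrtP _ sG).1.
Qed.

Lemma coefficient_growth c2 (u v : L2) q n : 0 < c2 -> Hdot e lam 1 u ->
  hs_norm e Qh (g (Theta u)) <= c2 * (1 + normHdot e lam 1 u) ->
  \sum_(k < n) @dot R H (g (Theta u) (Qh (e k))) (g (Theta u) (Qh (e k))) <=
  4 * c2 ^+ 2 * (1 + energy e lam u v q).
Proof.
move=> c20 hu gr; apply: le_trans (hs_partial_sum e_lam n (hs_sum_Theta hu)) _.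
have h0 : 0 <= hs_norm e Qh (g (Theta u)) by exact: sqrtr_ge0.
have n0 : 0 <= normHdot e lam 1 u by exact: sqrtr_ge0.
(* the factor 4 comes from (1 + x)^2 <= 2 + 2 x^2 <= 4 (1 + x^2 / 2) *)
rewrite /energy; move: (hs_norm _ _ _) (normHdot _ _ _ _) (norm2 _) gr h0 n0 => h N N' gr h0 n0.
have : h ^+ 2 <= (c2 * (1 + N)) ^+ 2 by rewrite ler_pXn2r// nnegrE (le_trans h0).
move=> /le_trans; apply; rewrite exprMn -mulrA [4 * _]mulrCA.
apply: ler_wpM2l; first exact: sqr_ge0.
by have := sqr_ge0 (1 - N); have := sqr_ge0 N'; have := sqr_ge0 q; nra.
Qed.

Lemma energy_ge0 (u v : L2) q : 0 <= energy e lam u v q.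
Proof.
rewrite /energy; apply: addr_ge0; last exact: sqr_ge0.
by apply: addr_ge0; apply: mulr_ge0; rewrite ?sqr_ge0 ?invr_ge0.
Qed.

Lemma energy_congr (u u' v v' : L2) q : Hdot e lam 1 u' -> eqL2 u u' -> eqL2 v v' ->
  energy e lam u v q = energy e lam u' v' q.
Proof.
move=> hu' uu' vv'.
have cu := (eqL2_coord e_lam u u').1 uu'.
have hu'' := (frac_domP e_lam (1 / 2) u').1 hu'.
have nv : norm2 v = norm2 v' := @norm_coord R H _ _ ((eqL2_coord e_lam v v').1 vv').
have nu : normHdot e lam 1 u = normHdot e lam 1 u'.
  exact: (@norm_pow_congr R H (1 / 2) u u' hu'' cu).
by rewrite /energy nu nv.
Qed.

End numerical_solution.

Section moments.
Context {R : realType} {d : nat} {T : R} {O : polygonal_domain R d}.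
Local Notation L2 := (L2 O).
Context (e : nat -> L2) (lam : nat -> R) (e_lam : dirichlet_eigenbasis e lam).
Local Notation H := (L2_spectral e_lam).
Context (E : R -> L2 * L2 -> L2 * L2) (E_group : is_wave_group e lam E).
Context {dW : measure_display} {Om : measurableType dW} (P : probability Om R).
Context (F : R -> set (set Om)) (F_filtration : is_filtration F).
Context (beta : nat -> R -> Om -> R) (beta_bm : is_iid_brownian P F beta).
Context (Qh : L2 -> L2) (f : L2 -> L2) (g : L2 * ('I_d -> L2) -> L2 -> L2).
Context (g_hs : forall u w, Hdot e lam 1 u -> is_hilbert_schmidt e Qh (g (u, w))).
Context (c2 : R) (c2_gt0 : 0 < c2) (b3 : mpoly.mpoly 2 R).
Context (g_growth : forall u, Hdot e lam 1 u ->
  hs_norm e Qh (g (Theta u)) <= c2 * (1 + normHdot e lam 1 u)).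
Context (g_lip : forall u u', Hdot e lam 1 u -> Hdot e lam 1 u' ->
  hs_norm e Qh (fun z => g (Theta u) z - g (Theta u') z) <=
  meval2 b3 (normHdot e lam 1 u) (normHdot e lam 1 u') *
  normHdot e lam 1 (u - u')).
Context (Ft : R -> R) (delta0 : R).
Context (u0 v0 : L2) (N : nat) (tau : R) (tau_gt0 : 0 < tau) (tauT : tau <= T).
Context (s : scheme) (extrapolated : bool).
Context (u v : nat -> Om -> L2) (q : nat -> Om -> R).
Context (sol : is_numerical_solution e lam E Qh f g Ft delta0 P F beta s
  extrapolated u0 v0 N tau u v q).

Let V n w := energy e lam (u n w) (v n w) (q n w).

Let time_ge0 n : 0 <= n%:R * tau.
Proof. by rewrite mulr_ge0// ltW. Qed.

Lemma energy_adapted n : (n <= N)%N ->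
  measurable_wrt (F (n%:R * tau)) (fun w => 1 + V n w).
Proof.
move=> nN; have sF := filtration_sigma F_filtration (time_ge0 n).
have hu w := (frac_domP e_lam (1 / 2) (u n w)).1 (sol_H1 sol w nN).
exact: (@measurable_wrt_energy R _ Om _ sF H (u n) (v n) (q n) hu
  (fun l => sol_u_adapted sol (e l) nN) (fun l => sol_v_adapted sol (e l) nN)
  (sol_q_adapted sol nN)).
Qed.

(** The events known at time [n tau] are independent of the increments of the
    Brownian motions over the step, whose variance is [tau]. *)
Lemma energy_moment_step n m : (n < N)%N ->
  (\int[P]_w ((1 + V n.+1 w) ^+ m.+1)%:E <=
   (1 + growth_cst T (4 * c2 ^+ 2) m * tau)%:E *
     \int[P]_w ((1 + V n w) ^+ m.+1)%:E)%E.
Proof.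
move=> nN; have nN' := ltnW nN.
pose b k w := beta k (n.+1%:R * tau) w - beta k (n%:R * tau) w.
pose future := sigma_gen [set X | exists k, X = b k].
have t0 := time_ge0 n; have t1 := time_ge0 n.+1.
have tt : n%:R * tau < n.+1%:R * tau by rewrite ltr_pM2r// ltr_nat.
have dt : n.+1%:R * tau - n%:R * tau = tau by rewrite -mulrBl -natrB// subSnn mul1r.
have noise : white_noise P tau b.
  by have := brownian_white_noise F_filtration beta_bm t0 tt; rewrite dt.
have sF := filtration_sigma F_filtration t0.
have mb k : measurable_fun setT (b k) := noise_measurable noise k.
have mfuture : future `<=` measurable.
  by apply: sigma_gen_measurable => _ [k ->].
pose a k w := g (Theta (u n w)) (Qh (e k)).
have C00 : 0 <= 4 * c2 ^+ 2 by rewrite mulr_ge0// sqr_ge0.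
apply: (@expected_step R dW Om P tau T b noise tau_gt0 tauT (F (n%:R * tau)) future
  sF (sigma_gen_sigma_algebra _) (filtration_meas F_filtration t0) mfuture
  (bm_indep_past beta_bm t0 (ltW tt)) _ H _ _ (v n) a (4 * c2 ^+ 2) m C00
  (energy_adapted nN')).
- by move=> k; apply: measurable_wrt_sigma_gen; exists k.
- exact: (adapted_measurable F_filtration t1 (energy_adapted nN)).
- exact (fun l => sol_v_adapted sol (e l) nN').
- exact (fun k l => measurable_wrt_coefficient (e_lam := e_lam) g_hs g_lip sF k l
    (fun w => sol_H1 sol w nN') (fun i => sol_u_adapted sol (e i) nN')).
- by move=> w; apply: ltr_pwDl; [exact: ltr01|exact: energy_ge0].
- move=> w; have hv : @dot R H (v n w) (v n w) = norm2 (v n w) ^+ 2 := esym (sqr_norm2 (v n w)).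
  rewrite hv /V /energy; move: (norm2 _) (normHdot _ _ _ _) => x y.
  by have := sqr_ge0 y; have := sqr_ge0 (q n w); lra.
- move=> j w; exact: coefficient_growth c2_gt0 (sol_H1 sol w nN')
    (g_growth (sol_H1 sol w nN')).
apply: filterS (sol_step sol nN) => w /= [hq [y [hy hstep]]].
have lim := @kinetic_gain_cvg R H (1 + V n w) (v n w) y
  (fun j => noise_vector (H := H) b (a ^~ w) j w) ((L2cvgP _ _).1 hy).
have step : V n.+1 w = V n w + ip (v n w) y + ip y y / 2 :=
  energy_step e_lam E_group (sol_H1 sol w nN') (sol_H1 sol w nN) hq hstep.
have -> : 1 + V n.+1 w = 1 + V n w + ip (v n w) y + ip y y / 2 by rewrite step !addrA.
exact lim.
Qed.

(** Iterating the one-step bound, with [1 + x <= expR x]. *)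
Lemma energy_moment n m : (n <= N)%N -> Hdot e lam 1 u0 ->
  (\int[P]_w ((1 + V n w) ^+ m.+1)%:E <=
   (expR (growth_cst T (4 * c2 ^+ 2) m * (n%:R * tau)) *
     (1 + energy e lam u0 v0 (sqrt_potential Ft delta0 u0)) ^+ m.+1)%:E)%E.
Proof.
move=> nN hu0; set K := growth_cst _ _ _; set V0 := energy _ _ _ _ _.
have T0 : 0 <= T by exact: le_trans (ltW tau_gt0) tauT.
have K0 : 0 <= K by apply: growth_cst_ge0 => //; rewrite mulr_ge0 ?sqr_ge0.
elim: n nN => [|n IHn] nN.
  rewrite mul0r mulr0 expR0 mul1r.
  have EV w : V 0%N w = V0.
    by rewrite /V (energy_congr e_lam _ hu0 (sol_u0 sol w) (sol_v0 sol w)) (sol_q0 sol w).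
  under eq_integral do rewrite EV.
  by rewrite integral_cst//= probability_setT mule1.
have step := energy_moment_step m nN.
apply: (le_trans step); apply: le_trans (lee_wpmul2l _ (IHn (ltnW nN))) _.
  by rewrite lee_fin addr_ge0// mulr_ge0// ltW.
have growth : (1 + K * tau) * expR (K * (n%:R * tau)) <= expR (K * (n.+1%:R * tau)).
  have -> : K * (n.+1%:R * tau) = K * tau + K * (n%:R * tau).
    by rewrite -natr1; ring.
  by rewrite expRD; apply: ler_wpM2r; [exact: expR_ge0|exact: expR_ge1Dx].
rewrite -EFinM lee_fin [leLHS]mulrA; apply: ler_wpM2r growth.
by rewrite exprn_ge0// addr_ge0// energy_ge0.
Qed.

End moments.

Theorem corollary3p1 (R : realType) (d : nat) (d_gt0 : (0 < d)%N)
    (d_le3 : (d <= 3)%N) (T : R) (T_gt0 : 0 < T) (O : polygonal_domain R d)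
    (e : nat -> L2 O) (lam : nat -> R) (e_lam : dirichlet_eigenbasis e lam)
    (E : R -> L2 O * L2 O -> L2 O * L2 O) (E_group : is_wave_group e lam E)
    (dW : measure_display) (Om : measurableType dW) (P : probability Om R)
    (F : R -> set (set Om)) (F_filtration : is_filtration F)
    (beta : nat -> R -> Om -> R) (beta_bm : is_iid_brownian P F beta)
    (Q Qh : L2 O -> L2 O) (Q_cov : is_covariance e Q) (Qh_sqrt : is_sqrt_op Q Qh)
    (f : L2 O -> L2 O) (g : L2 O * ('I_d -> L2 O) -> L2 O -> L2 O)
    (g_hs : forall u w, Hdot e lam 1 u -> is_hilbert_schmidt e Qh (g (u, w)))
    (u0 v0 : L2 O) (X0_HH : HH e lam (u0, v0))
    (k : nat) (k_gt0 : (0 < k)%N) (c2 : R) (c2_gt0 : 0 < c2)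
    (b1 : {poly R}) (b2 b3 : mpoly.mpoly 2 R)
    (b1_deg : size b1 = (2 * k + 1).+1)
    (b2_deg : total_degree b2 = (2 * k)%N)
    (b3_deg : total_degree b3 = k)
    (f_growth : forall u, Hdot e lam 1 u ->
      norm2 (f u) <= b1.[normHdot e lam 1 u])
    (f_lip : forall u u', Hdot e lam 1 u -> Hdot e lam 1 u' ->
      norm2 (f u - f u') <=
      meval2 b2 (normHdot e lam 1 u) (normHdot e lam 1 u') *
      normHdot e lam 1 (u - u'))
    (g_growth : forall u, Hdot e lam 1 u ->
      hs_norm e Qh (g (Theta u)) <= c2 * (1 + normHdot e lam 1 u))
    (g_lip : forall u u', Hdot e lam 1 u -> Hdot e lam 1 u' ->
      hs_norm e Qh (fun z => g (Theta u) z - g (Theta u') z) <=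
      meval2 b3 (normHdot e lam 1 u) (normHdot e lam 1 u') *
      normHdot e lam 1 (u - u'))
    (Ft : R -> R) (Ft_derivable : forall x, derivable Ft x 1)
    (f_Ft : forall u, Hdot e lam 1 u ->
      {ae leb O, forall x, f u x = derive1 Ft (u x)})
    (Ft_integrable : forall u, Hdot e lam 1 u ->
      (leb O).-integrable setT (fun x => (Ft (u x))%:E))
    (c3 c4 delta0 c : R) (c3_gt0 : 0 < c3) (c4_gt0 : 0 < c4)
    (delta0_gt0 : 0 < delta0) (c_gt0 : 0 < c)
    (F_coercive : forall u, Hdot e lam 1 u ->
      ((c3 * norm2 u ^+ 2)%:E +
       c4%:E * \int[leb O]_x (`|u x| ^+ (2 * k + 2))%:E <=
       (potential Ft u + delta0)%:E)%E)
    (F_lower : forall u, Hdot e lam 1 u -> c <= potential Ft u + delta0)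
    (p : R) (p_ge1 : 1 <= p) :
  exists C : R, 0 < C /\
    forall (N : nat) (tau : R), (0 < N)%N -> tau = T / N%:R ->
    forall (s : scheme) (extrapolated : bool)
      (u v : nat -> Om -> L2 O) (q : nat -> Om -> R),
      is_numerical_solution e lam E Qh f g Ft delta0 P F beta s extrapolated
        u0 v0 N tau u v q ->
    forall n : nat, (n <= N)%N ->
      ('E_P[fun w => (energy e lam (u n w) (v n w) (q n w) `^ p)%R] <= C%:E)%E.
Proof.
(* V^p <= (1 + V)^(m + 1) as soon as p <= m + 1, whether V <= 1 or not *)
pose m := Num.bound p; pose V0 := energy e lam u0 v0 (sqrt_potential Ft delta0 u0).
pose K := growth_cst T (4 * c2 ^+ 2) m.
have V00 : 0 <= V0 by exact: energy_ge0.
have K0 : 0 <= K by apply: growth_cst_ge0; rewrite ?mulr_ge0 ?sqr_ge0 ?ltW.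
have pm : p <= m.+1%:R.
  have := archi_boundP (le_trans ler01 p_ge1); rewrite -natr1 -/m => h.
  by rewrite (le_trans (ltW h))// lerDl.
exists (expR (K * T) * (1 + V0) ^+ m.+1); split.
  by rewrite mulr_gt0 ?expR_gt0// exprn_gt0// ltr_pwDl.
move=> N tau N0 tauE s extrapolated u v q sol n nN.
have N0' : 0 < N%:R :> R by rewrite ltr0n.
have tau0 : 0 < tau by rewrite tauE divr_gt0.
have NtauT : N%:R * tau = T by rewrite tauE mulrCA divff ?mulr1// gt_eqF.
have ntauT : n%:R * tau <= T by rewrite -NtauT ler_pM2r// ler_nat.
have tauT : tau <= T by rewrite -NtauT; apply: ler_peMl; [exact: ltW|rewrite ler1n].
have moment := energy_moment e_lam E_group F_filtration beta_bm g_hs c2_gt0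
  g_growth g_lip tau0 tauT sol m nN X0_HH.
have mV : measurable_fun setT (fun w => 1 + energy e lam (u n w) (v n w) (q n w)).
  have t0 : 0 <= n%:R * tau by rewrite mulr_ge0// ltW.
  exact (adapted_measurable F_filtration t0
    (energy_adapted e_lam F_filtration tau0 sol nN)).
rewrite unlock.
apply: (@le_trans _ _ (\int[P]_w ((1 + energy e lam (u n w) (v n w) (q n w)) ^+ m.+1)%:E)%E).
  apply: ge0_le_integral => //.
  - by move=> w _; rewrite lee_fin powR_ge0.
  - apply/measurable_EFinP.
    apply: (measurableT_comp (measurable_powR p)).
    have : measurable_fun setT (fun w => 1 + energy e lam (u n w) (v n w) (q n w) - 1).
      by apply: measurable_funB => //; exact: measurable_cst.
    by apply: eq_measurable_fun => w _; rewrite addrC addKr.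
  - exact/measurable_EFinP/measurable_funX.
  - move=> w _; rewrite lee_fin.
    have V1 : 1 <= 1 + energy e lam (u n w) (v n w) (q n w) by rewrite lerDl energy_ge0.
    apply: (@le_trans _ _ ((1 + energy e lam (u n w) (v n w) (q n w)) `^ p)).
      by apply: ge0_ler_powR; rewrite ?nnegrE ?energy_ge0 ?lerDr ?(le_trans ler01)//.
    rewrite -powR_mulrn; last by rewrite (le_trans ler01).
    exact: ler_powR.
apply: le_trans moment _; rewrite lee_fin; apply: ler_wpM2r.
  by rewrite exprn_ge0// addr_ge0.
by rewrite ler_expR; exact: ler_wpM2l.
Qed.
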